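(* Let $(\varphi_{s,t})$ be an evolution family over a canonical domain system $(D_t)_{t\ge0}=(\mathbb A_{r(t)})_{t\ge0}$. Assume that $r(T)=0$ for some $T\in[0,+\infty)$. Then $(\varphi_{s,t})$ is of type IV if $\varphi_{0,t}\to0$ as $t\to+\infty$, and of type II otherwise.
   Context: Notation: $\mathbb D:=\{z:|z|<1\}$, $\mathbb C^*:=\mathbb C\setminus\{0\}$, $\mathbb A_r:=\{z\in\mathbb C: r<|z|<1\}$ for $0\le r<1$, $\mathbb D^*:=\mathbb A_0$. For a closed curve $\gamma\subset\mathbb C^*$, $I(\gamma)$ is the index of the origin with respect to $\gamma$. For $d\in[1,+\infty]$, $AC^d(X,Y)$ is the class of all locally absolutely continuous $f:X\to Y$ with $f'\in L^d_{\mathrm{loc}}(X,\mathbb C)$. Put $\omega(r):=-\pi/\log r$ for $r\in(0,1)$ and $\omega(0):=0$. ''Univalent'' means holomorphic and injective. Convergence of holomorphic functions is uniform convergence on compacta. Canonical domain system of order $d$: a family $(D_t)_{t\ge0}$ of annuli $D_t=\mathbb A_{r(t)}$, $r(t)\in[0,1)$, such that $t\mapsto\omega(r(t))$ belongs to $AC^d([0,+\infty),[0,+\infty))$ and is non-increasing. (Thus $r$ is non-increasing; $r(T)=0$ for some $T$ means that $(D_t)$ is degenerate, i.e. $r\equiv0$, or of mixed type, i.e. $r>0$ on $[0,T_0)$ and $r=0$ on $[T_0,+\infty)$ for some $T_0>0$.) Evolution family of order $d$ over a canonical domain system $(D_t)$ of order $d$: a family $(\varphi_{s,t})_{0\le s\le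 t<+\infty}$ of holomorphic mappings $\varphi_{s,t}:D_s\to D_t$ such that (EF1) $\varphi_{s,s}=\mathrm{id}_{D_s}$; (EF2) $\varphi_{s,t}=\varphi_{u,t}\circ\varphi_{s,u}$ whenever $0\le s\le u\le t<+\infty$; (EF3) for any closed interval $I=[S,T]\subset[0,+\infty)$ and any $z\in D_S$ there is a non-negative function $k_{z,I}\in L^d([S,T],\mathbb R)$ such that $|\varphi_{s,u}(z)-\varphi_{s,t}(z)|\le\int_u^t k_{z,I}(\xi)\,d\xi$ whenever $S\le s\le u\le t\le T$. When no order is mentioned, the objects are of some order $d\in[1,+\infty]$. Loewner chain of order $d$ over $(D_t)$: a family $(f_t)_{t\ge0}$ of holomorphic functions $f_t:D_t\to\mathbb C$ such that (LC1) each $f_t$ is univalent; (LC2) $f_s(D_s)\subset f_t(D_t)$ whenever $0\le s<t<+\infty$; (LC3) for any compact interval $I=[S,T]\subset[0,+\infty)$ and any compact set $K\subset D_S$ there is a non-negative $k_{K,I}\in L^d([S,T],\mathbb R)$ such that $|f_s(z)-f_t(z)|\le\int_s^t k_{K,I}(\xi)\,d\xi$ for all $z\in K$ and all $S\le s\le t\le T$. It is associated with $(\varphi_{s,t})$ if $\varphi_{s,t}=f_t^{-1}\circ f_s$ for all $0\le s\le t$. Standard Loewner chain (with $r_\infty:=\lim_{t\to+\infty}r(t)$): a Loewner chain $(f_t)$ over $(D_t)$ such that $I(f_t\circ\gamma)=I(\gamma)$ for any closed curve $\gamma\subset D_t$ and any $t\ge0$; $\bigcup_{t\ge0}f_t(D_t)=\mathbb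 A_{r_\infty}$ if $0<r_\infty<1$; and $\bigcup_{t\ge0}f_t(D_t)\in\{\mathbb D^*,\ \mathbb C\setminus\overline{\mathbb D},\ \mathbb C^*\}$ if $r_\infty=0$. For every evolution family of order $d$ there is an associated standard Loewner chain $(f_t)$ of order $d$, unique up to rotation (and scaling if the union is $\mathbb C^*$); the domain $L[(\varphi_{s,t})]:=\bigcup_{t\ge0}f_t(D_t)$ is the Loewner range of $(\varphi_{s,t})$. Conformal type: $(\varphi_{s,t})$ is of type I if $L[(\varphi_{s,t})]=\mathbb A_\rho$ for some $\rho>0$; of type II if $L[(\varphi_{s,t})]=\mathbb D^*$; of type III if $L[(\varphi_{s,t})]=\mathbb C\setminus\overline{\mathbb D}$; of type IV if $L[(\varphi_{s,t})]=\mathbb C^*$. *)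

(* Defs.v *)
From HB Require Import structures.
From mathcomp Require Import all_boot all_order all_algebra.
From mathcomp Require Import all_classical all_reals all_analysis.
From mathcomp Require Import complex.

Set Implicit Arguments.
Unset Strict Implicit.
Unset Printing Implicit Defensive.

Import Order.TTheory GRing.Theory Num.Theory.
Import numFieldNormedType.Exports.

Local Open Scope classical_set_scope.
Local Open Scope complex_scope.
Local Open Scope ring_scope.

(* [R[i]] carries the analytic structure (topology, norm, derivatives) only
   through its regular module [R[i]^o]. The norm [`|z|] is [R[i]]-valued, hence
   the embeddings [x%:C] in comparisons. *)
Notation Cplx R := (R[i]^o).

Section Domains.
Context {R : realType}.

Definition annulus (r : R) : set (Cplx R) := [set z | r%:C < `|z| < 1].

Definition punctured_disk : set (Cplx R) := annulus 0.

Definition punctured_plane : set (Cplx R) := [set z | z != 0].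

Definition exterior_disk : set (Cplx R) := [set z | 1 < `|z|].

End Domains.

Section FunctionClasses.
Context {R : realType}.
Notation mu := (@lebesgue_measure R).

Definition Ld (d : \bar R) (S T : R) (k : R -> R) : Prop :=
  measurable_fun `[S, T] k /\ ('N[mu]_d[EFin \o (k \_ `[S, T])] < +oo)%E.

Definition abs_continuous (S T : R) (f : R -> R) : Prop :=
  forall e : R, 0 < e -> exists2 delta : R, 0 < delta &
  forall (n : nat) (a b : nat -> R),
    (forall i, (i < n)%N -> S <= a i /\ a i <= b i /\ b i <= T) ->
    trivIset `I_n (fun i => `]a i, b i[%classic) ->
    \sum_(i < n) (b i - a i) < delta ->
    \sum_(i < n) `|f (b i) - f (a i)| < e.

(* An absolutely continuous function is differentiable almost everywhere, so
   the values of [f^`()] at the other points are irrelevant. *)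
Definition ACd (d : \bar R) (f : R -> R) : Prop :=
  forall T : R, 0 <= T -> abs_continuous 0 T f /\ Ld d 0 T f^`()%classic.

Definition holomorphic (D : set (Cplx R)) (f : Cplx R -> Cplx R) : Prop :=
  forall z, D z -> derivable f z 1.

Definition univalent (D : set (Cplx R)) (f : Cplx R -> Cplx R) : Prop :=
  holomorphic D f /\ set_inj D f.

End FunctionClasses.

Section Index.
Context {R : realType}.

Definition closed_curve (D : set (Cplx R)) (g : R -> Cplx R) : Prop :=
  [/\ {within `[0, 1], continuous g},
      (forall t : R, 0 <= t <= 1 -> D (g t)) & g 0 = g 1].

Definition winding (g : R -> Cplx R) (n : int) : Prop :=
  exists theta : R -> R,
    [/\ {within `[0, 1], continuous theta},
        (forall t : R, 0 <= t <= 1 ->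
           g t != 0 /\ g t = `|g t| * (cos (theta t) +i* sin (theta t))) &
        theta 1 - theta 0 = 2 * pi * n%:~R].

(* The index of the origin; the default value 0 is only used when [g] is not
   a closed curve avoiding 0. *)
Definition index0 (g : R -> Cplx R) : int := xget 0 (winding g).

End Index.

Section Loewner.
Context {R : realType}.
Notation mu := (@lebesgue_measure R).
Implicit Types (d : \bar R) (r : R -> R).

Definition omega (x : R) : R := if x == 0 then 0 else - pi / ln x.

(* The system (D_t) = (A_{r(t)}) is represented by [r]. *)
Definition canonical_domain_system d r : Prop :=
  [/\ (forall t : R, 0 <= t -> 0 <= r t < 1),
      ACd d (omega \o r) &
      (forall s t : R, 0 <= s -> s <= t -> omega (r t) <= omega (r s))].

Record evolution_family d r (phi : R -> R -> Cplx R -> Cplx R) : Prop := {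
  ef_holo : forall s t : R, 0 <= s -> s <= t ->
    holomorphic (annulus (r s)) (phi s t);
  ef_maps : forall (s t : R) z, 0 <= s -> s <= t ->
    annulus (r s) z -> annulus (r t) (phi s t z);
  ef1 : forall (s : R) z, 0 <= s -> annulus (r s) z -> phi s s z = z;
  ef2 : forall (s u t : R) z, 0 <= s -> s <= u -> u <= t ->
    annulus (r s) z -> phi s t z = phi u t (phi s u z);
  ef3 : forall (S T : R) z, 0 <= S -> S <= T -> annulus (r S) z ->
    exists k : R -> R,
      [/\ (forall x : R, S <= x <= T -> 0 <= k x), Ld d S T k &
          forall s u t : R, S <= s -> s <= u -> u <= t -> t <= T ->
            `|phi s u z - phi s t z| <= (\int[mu]_(x in `[u, t]) k x)%:C] }.

Record loewner_chain d r (f : R -> Cplx R -> Cplx R) : Prop := {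
  lc1 : forall t : R, 0 <= t -> univalent (annulus (r t)) (f t);
  lc2 : forall s t : R, 0 <= s -> s < t ->
    f s @` annulus (r s) `<=` f t @` annulus (r t);
  lc3 : forall (S T : R) (K : set (Cplx R)), 0 <= S -> S <= T ->
    compact K -> K `<=` annulus (r S) ->
    exists k : R -> R,
      [/\ (forall x : R, S <= x <= T -> 0 <= k x), Ld d S T k &
          forall z (s t : R), K z -> S <= s -> s <= t -> t <= T ->
            `|f s z - f t z| <= (\int[mu]_(x in `[s, t]) k x)%:C] }.

(* phi_{s,t} = f_t^{-1} o f_s, the inverse being that of f_t : D_t -> f_t(D_t). *)
Definition associated r (f : R -> Cplx R -> Cplx R)
    (phi : R -> R -> Cplx R -> Cplx R) : Prop :=
  forall (s t : R) z, 0 <= s -> s <= t -> annulus (r s) z ->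
    annulus (r t) (phi s t z) /\ f t (phi s t z) = f s z.

Definition chain_range r (f : R -> Cplx R -> Cplx R) : set (Cplx R) :=
  \bigcup_(t in [set t : R | 0 <= t]) (f t @` annulus (r t)).

Definition standard_loewner_chain r (f : R -> Cplx R -> Cplx R) : Prop :=
  let rinf := lim (r t @[t --> +oo]) in
  [/\ (exists2 d : \bar R, (1 <= d)%E & loewner_chain d r f),
      (forall (t : R) g, 0 <= t -> closed_curve (annulus (r t)) g ->
         index0 (f t \o g) = index0 g),
      (0 < rinf < 1 -> chain_range r f = annulus rinf) &
      (rinf = 0 ->
         [\/ chain_range r f = punctured_disk,
             chain_range r f = exterior_disk |
             chain_range r f = punctured_plane])].

(* [L] is the union of the images of "the" standard Loewner chain associated
   with [phi]: such a chain exists and each of them has the union [L]. *)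
Definition loewner_range r (phi : R -> R -> Cplx R -> Cplx R)
    (L : set (Cplx R)) : Prop :=
  (exists f, standard_loewner_chain r f /\ associated r f phi) /\
  (forall f, standard_loewner_chain r f -> associated r f phi ->
     chain_range r f = L).

Definition type_I r phi : Prop :=
  exists2 rho : R, 0 < rho < 1 & loewner_range r phi (annulus rho).
Definition type_II r phi : Prop := loewner_range r phi punctured_disk.
Definition type_III r phi : Prop := loewner_range r phi exterior_disk.
Definition type_IV r phi : Prop := loewner_range r phi punctured_plane.

Definition cvg_on_compacta (D : set (Cplx R)) (g : R -> Cplx R -> Cplx R)
    (h : Cplx R -> Cplx R) : Prop :=
  forall K, compact K -> K `<=` D -> {uniform K, g t @[t --> +oo] --> h}.

End Loewner.

(* Main.v *)
Require Import Defs.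
From mathcomp Require Import all_boot all_order all_algebra.
From mathcomp Require Import all_classical all_reals all_analysis.
From mathcomp Require Import complex.
From mathcomp Require Import zify ring lra.
Set Implicit Arguments.
Unset Strict Implicit.
Unset Printing Implicit Defensive.
Import Order.TTheory GRing.Theory Num.Theory.
Import numFieldNormedType.Exports.
Local Open Scope ring_scope.
Local Open Scope classical_set_scope.

(** Let T be a time with r(T) = 0, let (f_t) be a standard Loewner chain associated
    with the evolution family, and let L be the union of its images. Since the
    radii tend to 0, L is the punctured disk, the exterior of the disk, or the
    punctured plane; it remains to decide which one from phi_{0,t}.

    For t >= T the function f_t is univalent on the punctured unit disk, has no
    zero, and turns once around 0 along every small circle. Hence its singularity
    at 0 is a simple zero of the extended function: f_t(x) / x has a nonzero limit
    at 0 ([univalent_simple_zero]). In particular L contains points close to 0 and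
    is not the exterior of the disk.

    If L is the punctured disk, Schwarz's lemma gives |f_t(x)| <= |x|, so that
    |phi_{0,t}(z)| >= |f_t(phi_{0,t}(z))| = |f_0(z)| > 0 for all t >= T, and
    phi_{0,t} does not tend to 0 ([disk_range_not_cvg]).

    If L is the punctured plane, then by compactness f_t(D_t) contains the punctured
    disk of any given radius q as soon as t is large. Schwarz's lemma for the inverse
    of f_t gives q |x| <= |f_t(x)|, so that |phi_{0,t}(z)| <= |f_0(z)| / q, and
    phi_{0,t} tends to 0 uniformly on compact sets ([plane_range_cvg]). Since L
    is one of these two sets, both claims follow.

    The complex analysis rests on a single integral theorem, Goursat's, for
    rectangles in logarithmic polar coordinates. It says that circle means of a
    holomorphic function do not depend on the radius, which rules out a strict
    quadratic maximum of a real part ([no_quadratic_max]). From this come a maximum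
    principle in which the function need not be holomorphic at its zeros
    ([rado_maximum_principle]), and then one which tolerates isolated singularities
    with local bounds ([punctured_maximum_principle]). The open mapping theorem, the
    removal of singularities, the order of a zero and both forms of Schwarz's lemma
    are applications of the latter to suitable quotients. *)

(** * Integrals of continuous functions over segments *)

Section SegmentIntegral.
Context {R : realType}.
Notation mu := (@lebesgue_measure R).
Implicit Types (a b c m M : R) (f g : R -> R).

Definition continuous_on_segment a b f :=
  forall x, a <= x <= b -> {for x, continuous f}.

Definition segment_integral a b f := \int[mu]_(x in `[a, b]) f x.

Lemma segment_integrable a b f : continuous_on_segment a b f ->
  mu.-integrable `[a, b] (EFin \o f).
Proof.
move=> cf; apply: continuous_compact_integrable; first exact: segment_compact.
apply: continuous_in_subspaceT => x; rewrite inE /= in_itv /= => xab.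
exact: cf.
Qed.

Lemma segment_integralB a b f g :
  continuous_on_segment a b f -> continuous_on_segment a b g ->
  segment_integral a b (fun x => f x - g x) =
  segment_integral a b f - segment_integral a b g.
Proof. by move=> cf cg; apply: RintegralB => //; exact: segment_integrable. Qed.

Lemma segment_integral_cst a b c : a <= b ->
  segment_integral a b (fun=> c) = c * (b - a).
Proof.
move=> ab; rewrite /segment_integral Rintegral_cst//=.
rewrite lebesgue_measure_itv /= lte_fin.
by case: ltgtP ab => // -> _; rewrite subrr.
Qed.

Lemma segment_integral_split a m b f : a <= m -> m <= b ->
  continuous_on_segment a b f ->
  segment_integral a b f = segment_integral a m f + segment_integral m b f.
Proof.
move=> am mb cf; have iab := segment_integrable cf.
have E := @Rintegral_itvB R f (BLeft a) (BRight b) m iab.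
rewrite !bnd_simp in E; rewrite /segment_integral.
rewrite -[LHS](subrK (\int[mu]_(x in `[a, m]) f x)) E// addrC; congr (_ + _).
apply: Rintegral_itv_obnd_cbnd; apply: integrableS iab => //.
by apply: subset_itvr; rewrite bnd_simp.
Qed.

Lemma le_segment_integral a b f g :
  continuous_on_segment a b f -> continuous_on_segment a b g ->
  (forall x, a <= x <= b -> f x <= g x) ->
  segment_integral a b f <= segment_integral a b g.
Proof.
move=> cf cg fg; by apply: le_Rintegral => //; exact: segment_integrable.
Qed.

Lemma segment_integral_bound a b f M : a <= b -> continuous_on_segment a b f ->
  (forall x, a <= x <= b -> `|f x| <= M) ->
  `|segment_integral a b f| <= M * (b - a).
Proof.
move=> ab cf fM; rewrite ler_norml -mulNr -!segment_integral_cst//.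
have cc c : continuous_on_segment a b (fun=> c) by move=> x _; exact: cst_continuous.
by apply/andP; split; apply: le_segment_integral => // x /fM;
  rewrite ler_norml => /andP[].
Qed.

End SegmentIntegral.
(** * Goursat's theorem for real one-forms on rectangles *)

Section Goursat.
Context {R : realType}.
Implicit Types (a b c d x y w h : R) (P Q : R -> R -> R).

Lemma nested_segments (u v : nat -> R) :
  {homo u : m n / (m <= n)%N >-> m <= n} ->
  {homo v : m n / (m <= n)%N >-> n <= m} ->
  (forall n, u n <= v n) -> exists x, forall n, u n <= x <= v n.
Proof.
move=> uI vD uv; have ub n m : u m <= v n.
  have [mn|nm] := leqP m n; first by rewrite (le_trans (uI _ _ mn)).
  by rewrite (le_trans (uv m))// vD// ltnW.
exists (sup (range u)) => n; apply/andP; split.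
  apply: sup_upper_bound; last by exists n.
  by split; [exists (u 0%N), 0%N | exists (v 0%N) => _ [m _ <-]].
by apply: ge_sup; [exists (u 0%N), 0%N | move=> _ [m _ <-]].
Qed.

(** Repeated quartering: the lower left corners of the chosen cells increase, the
    upper right corners decrease, and (x, y) lies in all the cells. *)
Lemma bisection2 w h (bad : nat -> R -> R -> Prop) a0 c0 : 0 <= w -> 0 <= h ->
  bad 0 a0 c0 ->
  (forall n a c, bad n a c -> exists i j : bool,
     bad n.+1 (a + i%:R * (w / 2 ^+ n.+1)) (c + j%:R * (h / 2 ^+ n.+1))) ->
  exists x y, forall n, exists a c,
    [/\ bad n a c, a <= x <= a + w / 2 ^+ n & c <= y <= c + h / 2 ^+ n].
Proof.
move=> w0 h0 bad0 badS.
have badS' (t : nat * R * R) : exists s : bool * bool,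
    bad t.1.1 t.1.2 t.2 -> bad t.1.1.+1 (t.1.2 + s.1%:R * (w / 2 ^+ t.1.1.+1))
                                       (t.2 + s.2%:R * (h / 2 ^+ t.1.1.+1)).
  case: t => [[n a] c] /=; have [/badS[i [j ij]]|nb] := pselect (bad n a c).
    by exists (i, j).
  by exists (false, false) => /nb.
have [s sP] := choice badS'.
pose p := fix p n : R * R := if n is m.+1 then
  ((p m).1 + (s (m, (p m).1, (p m).2)).1%:R * (w / 2 ^+ m.+1),
   (p m).2 + (s (m, (p m).1, (p m).2)).2%:R * (h / 2 ^+ m.+1)) else (a0, c0).
have badp n : bad n (p n).1 (p n).2.
  by elim: n => [|n IH] //; exact: (sP (n, (p n).1, (p n).2)).
have nest (v : R) (q : nat -> R) : 0 <= v ->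
    (forall n, exists i : bool, q n.+1 = q n + i%:R * (v / 2 ^+ n.+1)) ->
    exists x, forall n, q n <= x <= q n + v / 2 ^+ n.
  move=> v0 qS; apply: nested_segments.
  - apply: homo_leq => [//|? ? ?|n]; first exact: le_trans.
    have [i ->] := qS n; rewrite lerDl mulr_ge0// divr_ge0// exprn_ge0//.
  - apply: homo_leq => [//|y x z xy yz|n]; first exact: le_trans yz xy.
    have [i ->] := qS n.
    have -> : v / 2 ^+ n = 2 * (v / 2 ^+ n.+1).
      by rewrite exprS; field; rewrite expf_neq0.
    have : 0 <= v / 2 ^+ n.+1 by rewrite divr_ge0// exprn_ge0.
    by case: i => /=; lra.
  - by move=> n; rewrite lerDl divr_ge0// exprn_ge0.
have [x xP] := nest w (fun n => (p n).1) w0 (fun n => ex_intro _ _ erefl).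
have [y yP] := nest h (fun n => (p n).2) h0 (fun n => ex_intro _ _ erefl).
by exists x, y => n; exists (p n).1, (p n).2; split.
Qed.

Definition frechet2 P x y p q := forall e : R, 0 < e ->
  exists2 delta : R, 0 < delta & forall x' y',
    `|x' - x| < delta -> `|y' - y| < delta ->
    `|P x' y' - P x y - p * (x' - x) - q * (y' - y)|
      <= e * (`|x' - x| + `|y' - y|).

Lemma frechet2_swap P x y p q :
  frechet2 P x y p q -> frechet2 (fun y x => P x y) y x q p.
Proof.
move=> fP e e0; have [delta d0 dP] := fP e e0.
by exists delta => // y' x' yy xx; rewrite addrAC (addrC `|y' - y|); exact: dP.
Qed.

Lemma frechet2_continuous P x y p q : frechet2 P x y p q ->
  {for x, continuous (fun x => P x y)}.
Proof.
move=> /(_ 1 ltr01)[delta d0 dP].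
apply/cvgrPdist_le => /= e e0.
have k0 : 0 < `|p| + 1 by rewrite ltr_wpDl.
have := @nbhsx_ballx R R x (Num.min delta (e / (`|p| + 1))).
rewrite lt_min d0 divr_gt0// => /(_ isT); apply: filterS => z.
rewrite -ball_normE /= lt_min distrC => /andP[zd ze].
have := dP z y zd; rewrite subrr normr0 !addr0 mulr0 subr0 => /(_ d0).
rewrite mul1r => H; rewrite distrC.
rewrite ltr_pdivlMr// in ze.
have : `|P z y - P x y| <= `|P z y - P x y - p * (z - x)| + `|p * (z - x)|.
  by rewrite -{1}(subrK (p * (z - x)) (P z y - P x y)) ler_normD.
rewrite normrM; move: ze H; nra.
Qed.

(** Up to its sign, the integral of P dx + Q dy along the boundary. *)
Definition rectangle_integral P Q a b c d :=
  segment_integral a b (fun x => P x d - P x c) -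
  segment_integral c d (fun y => Q b y - Q a y).

(** The affine part of P dx + Q dy at (x, y) is closed, because the same q is the
    y-derivative of P and the x-derivative of Q; only the remainders contribute. *)
Lemma rectangle_integral_local P Q a b c d x y p q s e delta :
  a <= b -> c <= d -> a <= x <= b -> c <= y <= d ->
  (forall x, a <= x <= b -> forall y, c <= y <= d ->
     {for x, continuous (fun x => P x y)} /\ {for y, continuous (Q x)}) ->
  0 <= e -> b - a < delta -> d - c < delta ->
  (forall x' y', `|x' - x| < delta -> `|y' - y| < delta ->
    `|P x' y' - P x y - p * (x' - x) - q * (y' - y)|
      <= e * (`|x' - x| + `|y' - y|)) ->
  (forall x' y', `|x' - x| < delta -> `|y' - y| < delta ->
    `|Q x' y' - Q x y - q * (x' - x) - s * (y' - y)|
      <= e * (`|x' - x| + `|y' - y|)) ->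
  `|rectangle_integral P Q a b c d| <= 2 * e * ((b - a) + (d - c)) ^+ 2.
Proof.
move=> ab cd axb cyd cPQ e0 bad dcd dP dQ.
have cc l u k : continuous_on_segment l u (fun=> k : R).
  by move=> z _; exact: cst_continuous.
have cab : c <= c <= d by rewrite lexx.
have dab : c <= d <= d by rewrite cd lexx.
have aab : a <= a <= b by rewrite lexx.
have bab : a <= b <= b by rewrite ab lexx.
have cP : continuous_on_segment a b (fun x => P x d - P x c).
  by move=> z zab; apply: cvgB; [case: (cPQ z zab d dab)|case: (cPQ z zab c cab)].
have cQ : continuous_on_segment c d (fun y => Q b y - Q a y).
  by move=> z zab; apply: cvgB; [case: (cPQ b bab z zab)|case: (cPQ a aab z zab)].
set E := e * ((b - a) + (d - c)).
have HP : `|segment_integral a b (fun x => P x d - P x c) - q * (d - c) * (b - a)|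
    <= 2 * E * (b - a).
  rewrite -segment_integral_cst// -segment_integralB//.
  apply: segment_integral_bound => // [z zab|z zab].
    by apply: cvgB; [exact: cP|exact: cst_continuous].
  have zx : `|z - x| <= b - a by rewrite ler_norml; lra.
  have cy : `|c - y| <= d - c by rewrite ler_norml; lra.
  have dy : `|d - y| <= d - c by rewrite ler_norml; lra.
  have := dP z d (le_lt_trans zx bad) (le_lt_trans dy dcd).
  have := dP z c (le_lt_trans zx bad) (le_lt_trans cy dcd).
  have : e * (`|z - x| + `|d - y|) <= E by rewrite ler_wpM2l// lerD.
  have : e * (`|z - x| + `|c - y|) <= E by rewrite ler_wpM2l// lerD.
  rewrite !ler_norml; lra.
have HQ : `|segment_integral c d (fun y => Q b y - Q a y) - q * (b - a) * (d - c)|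
    <= 2 * E * (d - c).
  rewrite -segment_integral_cst// -segment_integralB//.
  apply: segment_integral_bound => // [z zab|z zab].
    by apply: cvgB; [exact: cQ|exact: cst_continuous].
  have zx : `|z - y| <= d - c by rewrite ler_norml; lra.
  have cy : `|a - x| <= b - a by rewrite ler_norml; lra.
  have dy : `|b - x| <= b - a by rewrite ler_norml; lra.
  have := dQ b z (le_lt_trans dy bad) (le_lt_trans zx dcd).
  have := dQ a z (le_lt_trans cy bad) (le_lt_trans zx dcd).
  have : e * (`|a - x| + `|z - y|) <= E by rewrite ler_wpM2l// lerD.
  have : e * (`|b - x| + `|z - y|) <= E by rewrite ler_wpM2l// lerD.
  rewrite !ler_norml; lra.
have -> : 2 * e * (b - a + (d - c)) ^+ 2 = 2 * E * (b - a) + 2 * E * (d - c).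
  by rewrite /E; ring.
rewrite /rectangle_integral.
move: HP HQ; rewrite !ler_norml.
move: (segment_integral a b _) (segment_integral c d _) => u v; lra.
Qed.

Lemma rectangle_integral_splitx P Q a m b c d : a <= m -> m <= b -> c <= d ->
  (forall x, a <= x <= b -> forall y, c <= y <= d ->
     {for x, continuous (fun x => P x y)} /\ {for y, continuous (Q x)}) ->
  rectangle_integral P Q a b c d =
  rectangle_integral P Q a m c d + rectangle_integral P Q m b c d.
Proof.
move=> am mb cd cPQ.
have cab : c <= c <= d by rewrite lexx.
have dab : c <= d <= d by rewrite cd lexx.
have cQ x : a <= x <= b -> continuous_on_segment c d (Q x).
  by move=> xab y ycd; case: (cPQ x xab y ycd).
have aP : a <= a <= b by lra.
have mP : a <= m <= b by lra.
have bP : a <= b <= b by lra.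
rewrite /rectangle_integral (@segment_integral_split _ a m b)//; last first.
  by move=> z zab; apply: cvgB; [case: (cPQ z zab d dab)|case: (cPQ z zab c cab)].
by rewrite !(@segment_integralB _ c d); [lra| exact: cQ..].
Qed.

Lemma rectangle_integral_swap P Q a b c d :
  rectangle_integral (fun y x => Q x y) (fun y x => P x y) c d a b =
  - rectangle_integral P Q a b c d.
Proof. by rewrite /rectangle_integral opprB. Qed.

Lemma rectangle_integral_quarters P Q a m b c n d :
  a <= m -> m <= b -> c <= n -> n <= d ->
  (forall x, a <= x <= b -> forall y, c <= y <= d ->
     {for x, continuous (fun x => P x y)} /\ {for y, continuous (Q x)}) ->
  rectangle_integral P Q a b c d =
  rectangle_integral P Q a m c n + rectangle_integral P Q a m n d +
  (rectangle_integral P Q m b c n + rectangle_integral P Q m b n d).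
Proof.
move=> am mb cn nd cPQ; rewrite (rectangle_integral_splitx am mb (le_trans cn nd) cPQ).
have splity x1 x2 : a <= x1 -> x1 <= x2 -> x2 <= b ->
    rectangle_integral P Q x1 x2 c d =
    rectangle_integral P Q x1 x2 c n + rectangle_integral P Q x1 x2 n d.
  move=> ax1 x12 x2b; apply: oppr_inj.
  have := @rectangle_integral_splitx
    (fun t z => Q z t) (fun t z => P z t) c n d x1 x2 cn nd x12.
  rewrite !(@rectangle_integral_swap P Q) => ->; first by rewrite -opprD.
  move=> t tcd z /andP[xz zx].
  by have [] := cPQ z _ t tcd; first by rewrite (le_trans ax1)// (le_trans zx).
by rewrite !splity// ?(le_trans am) ?(le_trans _ mb).
Qed.

(** Pointwise differentiability suffices, with no continuity of the partial
    derivatives: a nonzero boundary integral would pass, divided by at most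
    four, to one quarter of the rectangle, then to one quarter of that quarter,
    and so on, whereas differentiability at the limit point makes the integral
    over the quarters shrink faster than their area. *)
Lemma goursat P Q a b c d : a < b -> c < d ->
  (forall x, a <= x <= b -> forall y, c <= y <= d ->
     exists p q s, frechet2 P x y p q /\ frechet2 Q x y q s) ->
  rectangle_integral P Q a b c d = 0.
Proof.
move=> ab cd dPQ.
have cPQ x : a <= x <= b -> forall y, c <= y <= d ->
    {for x, continuous (fun x => P x y)} /\ {for y, continuous (Q x)}.
  move=> xab y ycd; have [p [q [s [fP fQ]]]] := dPQ x xab y ycd.
  by split; [exact: frechet2_continuous fP|exact: frechet2_continuous (frechet2_swap fQ)].
apply/eqP/negPn/negP => J0.
set J := rectangle_integral P Q in J0 *.
pose w n := (b - a) / 2 ^+ n; pose h n := (d - c) / 2 ^+ n.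
have w0 n : 0 < w n by rewrite divr_gt0 ?exprn_gt0//; lra.
have h0 n : 0 < h n by rewrite divr_gt0 ?exprn_gt0//; lra.
have wS n : w n = 2 * w n.+1 by rewrite /w exprS; field; rewrite expf_neq0.
have hS n : h n = 2 * h n.+1 by rewrite /h exprS; field; rewrite expf_neq0.
pose bad n x y := [/\ a <= x, x + w n <= b, c <= y, y + h n <= d &
  `|J a b c d| <= 4 ^+ n * `|J x (x + w n) y (y + h n)|].
have [] := @bisection2 (b - a) (d - c) bad a c; [lra|lra| | |].
- rewrite /bad /w /h !expr0 !divr1 !mul1r !(addrC _ (_ - _)) !subrK.
  by split.
- move=> n x y [ax xb cy yd Jn]; rewrite -/(w n.+1) -/(h n.+1).
  have wn := w0 n.+1; have hn := h0 n.+1; rewrite wS in xb Jn; rewrite hS in yd Jn.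
  have cPQ' : forall z, x <= z <= x + 2 * w n.+1 ->
      forall t, y <= t <= y + 2 * h n.+1 ->
      {for z, continuous (fun x => P x t)} /\ {for t, continuous (Q z)}.
    by move=> z zx t ty; apply: cPQ; lra.
  have Jq : J x (x + 2 * w n.+1) y (y + 2 * h n.+1) =
      J x (x + w n.+1) y (y + h n.+1) +
      J x (x + w n.+1) (y + h n.+1) (y + 2 * h n.+1) +
      (J (x + w n.+1) (x + 2 * w n.+1) y (y + h n.+1) +
       J (x + w n.+1) (x + 2 * w n.+1) (y + h n.+1) (y + 2 * h n.+1)).
    by apply: rectangle_integral_quarters cPQ'; clear -wn hn; lra.
  rewrite Jq in Jn.
  have two t u : t + 2 * u = t + u + u :> R by lra.
  rewrite !two in Jn.
  set J1 := J x (x + w n.+1) y (y + h n.+1) in Jn; set J2 := J x _ _ _ in Jn.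
  set J3 := J (_ + _) _ _ _ in Jn; set J4 := J (_ + _) _ _ _ in Jn.
  have p4 : 0 < 4 ^+ n :> R by rewrite exprn_gt0.
  have {}Jn : `|J a b c d| <= 4 ^+ n * (`|J1| + `|J2| + `|J3| + `|J4|).
    apply: (le_trans Jn); rewrite ler_pM2l//.
    move: J1 J2 J3 J4 {Jn} => J1 J2 J3 J4; have := ler_normD (J1 + J2) (J3 + J4).
    by have := ler_normD J1 J2; have := ler_normD J3 J4; clear; lra.
  have key (K : R) : 4 ^+ n * `|K| < `|J a b c d| / 4 \/
      `|J a b c d| <= 4 ^+ n.+1 * `|K|.
    rewrite exprS; case: (ltP (4 ^+ n * `|K|) (`|J a b c d| / 4)) => H; first by left.
    by right; clear -H; lra.
  case: (key J1) => [k1|H]; last first.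
    by exists false, false; rewrite !mul0r !addr0; split=> //; clear -ax xb cy yd wn hn; lra.
  case: (key J2) => [k2|H]; last first.
    by exists false, true; rewrite !mul0r !addr0 mul1r; split=> //;
      clear -ax xb cy yd wn hn; lra.
  case: (key J3) => [k3|H]; last first.
    by exists true, false; rewrite !mul0r !addr0 mul1r; split=> //;
      clear -ax xb cy yd wn hn; lra.
  case: (key J4) => [k4|H]; last first.
    by exists true, true; rewrite !mul1r; split=> //; clear -ax xb cy yd wn hn; lra.
  by exfalso; clear -k1 k2 k3 k4 Jn; lra.
move=> x [y xyP].
have [a1 [c1 [[aa1 ba1 cc1 dc1 _] xa1 yc1]]] := xyP 0%N.
rewrite -/(w 0%N) -/(h 0%N) in xa1 yc1.
have xab : a <= x <= b by clear -aa1 ba1 xa1; lra.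
have ycd : c <= y <= d by clear -cc1 dc1 yc1; lra.
have [p [q [s [fP fQ]]]] := dPQ x xab y ycd.
set D := (b - a) + (d - c).
have D0 : 0 < D by rewrite /D; lra.
have J0' : 0 < `|J a b c d| by rewrite normr_gt0.
(* For this e the local estimate is half the lower bound |J a b c d| / 4^n. *)
pose e := `|J a b c d| / (4 * D ^+ 2).
have e0 : 0 < e by rewrite divr_gt0// mulr_gt0// exprn_gt0.
have [d1 d10 d1P] := fP e e0.
have [d2 d20 d2P] := fQ e e0.
pose delta := Num.min d1 d2.
have de0 : 0 < delta by rewrite lt_min d10.
have [n nD] : exists n, D / 2 ^+ n < delta.
  exists (Num.bound (D / delta)); have nP := upper_nthrootP (leqnn (Num.bound (D / delta))).
  rewrite ltr_pdivrMr ?exprn_gt0// mulrC -ltr_pdivrMr//; exact: nP.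
have [x1 [y1 [[ax xb cy yd Jn] xx yy]]] := xyP n.
rewrite -/(w n) -/(h n) in xx yy.
have wn := w0 n; have hn := h0 n.
have wh : w n + h n = D / 2 ^+ n by rewrite /w /h -mulrDl.
have sx : x1 + w n - x1 = w n by rewrite addrC addKr.
have sy : y1 + h n - y1 = h n by rewrite addrC addKr.
have JJ : `|J x1 (x1 + w n) y1 (y1 + h n)| <= 2 * e * (w n + h n) ^+ 2.
  rewrite -{2}sx -{2}sy.
  apply: (@rectangle_integral_local P Q x1 _ y1 _ x y p q s e delta);
    rewrite ?sx ?sy//.
  - by rewrite lerDl ltW.
  - by rewrite lerDl ltW.
  - by move=> z zx t ty; apply: cPQ; clear -ax xb cy yd zx ty; lra.
  - exact: ltW.
  - by clear -wh nD hn; lra.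
  - by clear -wh nD wn; lra.
  - by move=> x' y' xx' yy'; apply: d1P; [move: xx'|move: yy']; rewrite lt_min => /andP[].
  - by move=> x' y' xx' yy'; apply: d2P; [move: xx'|move: yy']; rewrite lt_min => /andP[].
move: Jn; rewrite leNgt => /negP; apply.
apply: (@le_lt_trans _ _ (4 ^+ n * (2 * e * (w n + h n) ^+ 2))).
  by rewrite ler_pM2l ?exprn_gt0.
have p4 : 4 ^+ n != 0 :> R by rewrite expf_neq0.
have <- : (2 ^+ n) ^+ 2 = 4 ^+ n :> R by rewrite exprAC; congr (_ ^+ n); ring.
have p2 : 2 ^+ n != 0 :> R by rewrite expf_neq0.
have -> : (2 ^+ n) ^+ 2 * (2 * e * (w n + h n) ^+ 2) = `|J a b c d| / 2.
  by rewrite wh /e; field; rewrite p2 (gt_eqF D0).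
by clear -J0'; lra.
Qed.

End Goursat.
(** * The modulus and the topology of the complex plane *)

Section Modulus.
Context {R : realType}.
Notation C := (Cplx R).
Implicit Types (z w : C) (x y : R).

(** The norm of the plane takes its values in [R[i]]; estimates are made with this
    real-valued version. *)
Definition cmod z : R := Normc.normc z.

Arguments cmod : simpl never.

Lemma normE z : `|z| = (cmod z)%:C%C :> R[i].
Proof. by []. Qed.

Lemma ltc_normE x z : (`|z| < x%:C%C) = (cmod z < x).
Proof. by rewrite normE ltcR. Qed.
Lemma ltc_normE' x z : (x%:C%C < `|z|) = (x < cmod z).
Proof. by rewrite normE ltcR. Qed.
Lemma cmod_ge0 z : 0 <= cmod z.
Proof. by rewrite -lecR -normE normr_ge0. Qed.

Lemma cmodM z w : cmod (z * w) = cmod z * cmod w.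
Proof. exact: Normc.normcM. Qed.

Lemma cmodV z : cmod z^-1 = (cmod z)^-1.
Proof. exact: Normc.normcV. Qed.

Lemma cmod0 : cmod 0 = 0. Proof. exact: Normc.normc0. Qed.
Lemma cmod1 : cmod 1 = 1. Proof. exact: Normc.normc1. Qed.

Lemma cmodX z n : cmod (z ^+ n) = cmod z ^+ n.
Proof. by elim: n => [|n IH]; rewrite ?cmod1// !exprS cmodM IH. Qed.

Lemma cmod_gt0 z : (0 < cmod z) = (z != 0).
Proof. by rewrite -ltcR -normE normr_gt0. Qed.

Lemma cmodN z : cmod (- z) = cmod z.
Proof. by apply: complexI; rewrite -!normE normrN. Qed.

Lemma cmodB z w : cmod (z - w) = cmod (w - z).
Proof. by rewrite -opprB cmodN. Qed.

Lemma ler_cmodD z w : cmod (z + w) <= cmod z + cmod w.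
Proof. by rewrite -lecR rmorphD /= -!normE ler_normD. Qed.

Lemma ler_cmodB z w : cmod (z - w) <= cmod z + cmod w.
Proof. by rewrite -(cmodN w) ler_cmodD. Qed.

Lemma ler_cmod_dist z w : cmod z - cmod w <= cmod (z - w).
Proof. by rewrite lerBlDr (le_trans _ (ler_cmodD _ _))// subrK. Qed.

Lemma cmod_real x : cmod (x%:C%C) = `|x|.
Proof. by rewrite /cmod /= expr0n /= addr0 sqrtr_sqr. Qed.

Lemma complex_ext z w :
  complex.Re z = complex.Re w -> complex.Im z = complex.Im w -> z = w.
Proof. by case: z; case: w => a b c d /= -> ->. Qed.

Lemma cReD z w : complex.Re (z + w) = complex.Re z + complex.Re w.
Proof. by case: z; case: w. Qed.
Lemma cReB z w : complex.Re (z - w) = complex.Re z - complex.Re w.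
Proof. by case: z; case: w. Qed.
Lemma cImB z w : complex.Im (z - w) = complex.Im z - complex.Im w.
Proof. by case: z; case: w. Qed.
Lemma cReM z w :
  complex.Re (z * w) = complex.Re z * complex.Re w - complex.Im z * complex.Im w.
Proof. by case: z; case: w. Qed.
Lemma cImM z w :
  complex.Im (z * w) = complex.Re z * complex.Im w + complex.Im z * complex.Re w.
Proof. by case: z; case: w. Qed.

Lemma cmodE z : cmod z = Num.sqrt (complex.Re z ^+ 2 + complex.Im z ^+ 2).
Proof. by case: z. Qed.

Lemma sqr_cmod z : cmod z ^+ 2 = complex.Re z ^+ 2 + complex.Im z ^+ 2.
Proof. by rewrite cmodE sqr_sqrtr// addr_ge0// sqr_ge0. Qed.

Lemma ler_Re z : `|complex.Re z| <= cmod z.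
Proof. by rewrite cmodE -sqrtr_sqr ler_wsqrtr// lerDl sqr_ge0. Qed.

Lemma ler_Im z : `|complex.Im z| <= cmod z.
Proof. by rewrite cmodE -sqrtr_sqr ler_wsqrtr// lerDr sqr_ge0. Qed.

Lemma cmod_le_ReIm z : cmod z <= `|complex.Re z| + `|complex.Im z|.
Proof.
case: z => a b /=.
have E : (a +i* b)%C = a%:C%C + (0 +i* b)%C :> C.
  by apply/eqP; rewrite eq_complex /= addr0 add0r !eqxx.
rewrite [X in cmod X]E; apply: (le_trans (ler_cmodD _ _)); rewrite cmod_real lerD2l.
by rewrite /cmod /= expr0n /= add0r sqrtr_sqr.
Qed.

End Modulus.
Arguments cmod {R} z : simpl never.

Section Topology.
Context {R : realType}.
Notation C := (Cplx R).
Implicit Types (z w : C) (x y : R).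

Lemma nbhs_cmodP z (U : set C) :
  nbhs z U <-> exists2 delta : R, 0 < delta & forall w, cmod (w - z) < delta -> U w.
Proof.
split=> [/nbhs_ballP[e /= e0 eU]|[delta d0 dU]].
  case: e e0 eU => a b; rewrite ltcE /= => /andP[/eqP-> a0] eU.
  exists a => // w wz; apply: eU.
  by rewrite -ball_normE /= -opprB normrN; rewrite -ltc_normE in wz.
apply/nbhs_ballP; exists (delta%:C%C); first by rewrite /= ltcR.
by move=> w; rewrite -ball_normE /= -opprB normrN ltc_normE; exact: dU.
Qed.

Lemma dnbhs_cmodP z (U : set C) : z^' U <->
  exists2 delta : R, 0 < delta & forall w, w != z -> cmod (w - z) < delta -> U w.
Proof.
apply: (iff_trans (@nbhs_cmodP z [set w | w != z -> U w])).
by split=> -[delta d0 dU]; exists delta => // w; [move=> wz /dU; apply|move=> /dU H wz; apply: H].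
Qed.

Lemma cvg_cmodP (T : Type) (F : set_system T) {FF : Filter F} (f : T -> C) z :
  f @ F --> z <-> forall e : R, 0 < e -> \forall t \near F, cmod (f t - z) < e.
Proof.
split=> [fz e e0|fz].
  apply: (fz [set w | cmod (w - z) < e]).
  by apply/nbhs_cmodP; exists e.
move=> U /nbhs_cmodP[e e0 eU]; apply: filterS (fz e e0) => t; exact: eU.
Qed.

Lemma cvg_at_cmodP (f : C -> C) z a : f w @[w --> z] --> a <->
  forall e : R, 0 < e -> \forall w \near z, cmod (f w - a) < e.
Proof. exact: (@cvg_cmodP C (nbhs z) (nbhs_filter z)). Qed.

Lemma cvg_punctured_cmodP (f : C -> C) z a : f w @[w --> z^'] --> a <->
  forall e : R, 0 < e -> exists2 delta : R, 0 < delta &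
    forall w, w != z -> cmod (w - z) < delta -> cmod (f w - a) < e.
Proof.
apply: (iff_trans (@cvg_cmodP C (z^') (dnbhs_filter z) f a)).
by split=> H e e0; apply/dnbhs_cmodP; exact: H.
Qed.

Lemma cvg_Re (T : Type) (F : set_system T) {FF : Filter F} (f : T -> C) z :
  f @ F --> z -> (fun t => complex.Re (f t)) @ F --> complex.Re z.
Proof.
move=> /cvg_cmodP fz; apply/cvgrPdist_lt => e e0.
apply: filterS (fz e e0) => t; apply: le_lt_trans.
by rewrite distrC -cReB ler_Re.
Qed.

Lemma cvg_cmod (T : Type) (F : set_system T) {FF : Filter F} (f : T -> C) z :
  f @ F --> z -> (fun t => cmod (f t)) @ F --> cmod z.
Proof.
move=> /cvg_cmodP fz; apply/cvgrPdist_lt => e e0.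
apply: filterS (fz e e0) => t; apply: le_lt_trans.
rewrite ler_norml; apply/andP; split.
  by rewrite lerNl opprB ler_cmod_dist.
by rewrite cmodB ler_cmod_dist.
Qed.

Lemma cvg_at_cmod (f : C -> C) z a :
  f w @[w --> z] --> a -> (fun w => cmod (f w)) @ z --> cmod a.
Proof. exact: (@cvg_cmod C (nbhs z) (nbhs_filter z)). Qed.

Lemma continuous_cmodB a : continuous (fun w : C => cmod (w - a)).
Proof.
move=> w; apply: (@cvg_at_cmod (fun w => w - a)).
exact: (@cvgB _ _ _ (nbhs w) _ id (fun=> a) w a cvg_id (cvg_cst a)).
Qed.

Lemma cvg_ReIm (T : Type) (F : set_system T) {FF : Filter F} (f : T -> C) z :
  (fun t => complex.Re (f t)) @ F --> complex.Re z ->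
  (fun t => complex.Im (f t)) @ F --> complex.Im z -> f @ F --> z.
Proof.
move=> /cvgrPdist_lt fr /cvgrPdist_lt fi; apply/cvg_cmodP => e e0.
have e2 : 0 < e / 2 by rewrite divr_gt0.
apply: filterS2 (fr _ e2) (fi _ e2) => t rt it.
apply: (le_lt_trans (cmod_le_ReIm _)).
by rewrite distrC -cReB in rt; rewrite distrC -cImB in it; lra.
Qed.

Lemma compact_closed_disk z (r : R) : compact [set w : C | cmod (w - z) <= r].
Proof.
pose S := (`[complex.Re z - r, complex.Re z + r] `*`
           `[complex.Im z - r, complex.Im z + r])%classic : set (R * R).
pose f (p : R * R) : C := (p.1 +i* p.2)%C.
have cf : continuous f.
  move=> p; apply: cvg_ReIm => /=; first exact: cvg_fst.
  exact: cvg_snd.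
have cS : compact S by apply: compact_setX; exact: segment_compact.
have cfS : compact (f @` S).
  by apply: continuous_compact => //; exact: continuous_subspaceT.
apply: (subclosed_compact _ cfS).
  pose g w := cmod (w - z).
  have cg : continuous g by exact: continuous_cmodB.
  have -> : [set w : C | cmod (w - z) <= r] = g @^-1` [set x | x <= r] by [].
  by apply: closed_comp => [w _|]; [exact: cg|exact: closed_le].
move=> w /= wz; exists (complex.Re w, complex.Im w); last by case: w {wz}.
have := le_trans (ler_Re _) wz; have := le_trans (ler_Im _) wz.
by rewrite cReB cImB !ler_norml => *; split; rewrite /= in_itv /=; lra.
Qed.

End Topology.
(** * Complex derivatives in logarithmic polar coordinates *)

Section ComplexDerivative.
Context {R : realType}.
Notation C := (Cplx R).
Implicit Types (f g F : C -> C) (z w : C).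

Lemma cderivableD f g z :
  derivable f z 1 -> derivable g z 1 -> derivable (fun w => f w + g w : C) z 1.
Proof. by move=> df dg; exact: (@derivableD R[i] C C f g z 1 df dg). Qed.

Lemma cderivableB f g z :
  derivable f z 1 -> derivable g z 1 -> derivable (fun w => f w - g w : C) z 1.
Proof. by move=> df dg; exact: (@derivableB R[i] C C f g z 1 df dg). Qed.

Lemma cderivableM f g z :
  derivable f z 1 -> derivable g z 1 -> derivable (fun w => f w * g w : C) z 1.
Proof. by move=> df dg; exact: (@derivableM R[i] C f g z 1 df dg). Qed.

Lemma cderivableV f z : f z != 0 ->
  derivable f z 1 -> derivable (fun w => (f w)^-1 : C) z 1.
Proof. by move=> fz df; exact: (@derivableV R[i] C f z 1 fz df). Qed.

Lemma cderivable_cst (a z : C) : derivable (fun=> a : C) z 1.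
Proof. exact: derivable_cst. Qed.

Lemma cderivable_id z : derivable (fun w : C => w) z 1.
Proof. exact: (@derivable_id R[i] C z 1). Qed.

Lemma cderivableX f n z :
  derivable f z 1 -> derivable (fun w => f w ^+ n : C) z 1.
Proof.
move=> df; elim: n => [|n IH]; first exact: cderivable_cst.
by under eq_fun do rewrite exprS; exact: cderivableM.
Qed.

Lemma cderivable_continuous f z : derivable f z 1 -> f w @[w --> z] --> f z.
Proof.
by move=> df; exact/differentiable_continuous/(@derivable1_diffP R[i] C f z).1.
Qed.

Lemma cderivable_approx f z : derivable f z 1 -> exists a : C,
  forall e : R, 0 < e -> exists2 delta : R, 0 < delta &
  forall w, cmod (w - z) < delta ->
    cmod (f w - f z - a * (w - z)) <= e * cmod (w - z).
Proof.
move=> df; exists ('D_1 f z) => e e0.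
move: df; rewrite /derivable => /cvg_cmodP/(_ e e0)/dnbhs_cmodP[delta d0 dP].
exists delta => // w wz.
have [->|nwz] := eqVneq w z; first by rewrite !subrr mulr0 subr0 cmod0 mulr0.
have nwz' : w - z != 0 by rewrite subr_eq0.
have := dP (w - z) nwz'; rewrite subr0 => /(_ wz) /= /ltW.
rewrite -[_ *: 1]/((w - z) * 1 : C) mulr1 subrK -/(derive f z 1).
rewrite -(ler_pM2r (_ : 0 < cmod (w - z))) ?cmod_gt0//; apply: le_trans.
rewrite -cmodM mulrBl -[_ *: _]/((w - z)^-1 * (f w - f z) : C) mulrAC mulVf// mul1r.
exact: lexx.
Qed.

End ComplexDerivative.

Section LogPolar.
Context {R : realType}.
Notation C := (Cplx R).
Implicit Types (x y h k t r : R) (F : C -> C).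

Definition cis t : C := (cos t +i* sin t)%C.

Lemma cmod_cis t : cmod (cis t) = 1.
Proof. by rewrite cmodE /= cos2Dsin2 sqrtr1. Qed.

Lemma cisD s t : cis (s + t) = cis s * cis t.
Proof.
apply: complex_ext; rewrite ?cReM ?cImM /= ?cosD// sinD.
by rewrite addrC.
Qed.

Lemma is_derive_approx (f : R -> R) x df : is_derive x 1 f df ->
  forall e, 0 < e -> exists2 delta, 0 < delta & forall h, `|h| < delta ->
    `|f (x + h) - f x - df * h| <= e * `|h|.
Proof.
case=> fx fdf e e0; move: fx; rewrite /derivable => /cvgrPdist_le /(_ e e0).
rewrite -/(derive f x 1) fdf.
move=> /nbhs_ballP[delta /= d0 dP]; exists delta => // h hd.
have [->|h0] := eqVneq h 0; first by rewrite addr0 subrr mulr0 subrr normr0 mulr0.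
have := dP h; rewrite -ball_normE /= sub0r normrN => /(_ hd h0).
rewrite -[h *: 1]/(h * 1) mulr1 -(ler_pM2r (_ : 0 < `|h|)) ?normr_gt0//.
apply: le_trans; rewrite -normrM distrC mulrBl.
rewrite -[_ *: _]/(h^-1 * (f (h + x) - f x)) mulrAC mulVf// mul1r (addrC x); exact: lexx.
Qed.

(** Here e^h cis k is the exponential of h + i k; by the addition formulas its
    expansion at 0 determines the one at every point. *)
Lemma cexp_approx0 e : 0 < e -> exists2 delta, 0 < delta & forall h k,
  `|h| < delta -> `|k| < delta ->
  cmod ((expR h)%:C%C * cis k - 1 - (h +i* k)%C) <= e * (`|h| + `|k|).
Proof.
move=> e0.
have [n [n0 n8 n1]] : exists n : R, [/\ 0 < n, n <= e / 8 & n <= 1].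
  exists (Num.min (e / 8) 1).
  by split; rewrite ?lt_min ?ltr01 ?divr_gt0// ge_min lexx ?orbT.
have [d1 d10 d1P] := is_derive_approx (is_derive_expR 0) n0.
have [d2 d20 d2P] := is_derive_approx (is_derive_cos 0) n0.
have [d3 d30 d3P] := is_derive_approx (is_derive_sin 0) n0.
exists (Num.min n (Num.min d1 (Num.min d2 d3))); first by rewrite !lt_min n0 d10 d20.
move=> h k; rewrite !lt_min => /and4P[hn /d1P + _ _] /and4P[_ _ /d2P + /d3P].
rewrite !add0r expR0 cos0 sin0 oppr0 mul0r !mul1r !subr0 addr0 => H1 H2 H3.
have E2 : `|expR h| <= 3.
  have := ler_normD (expR h - 1 - h) (1 + h).
  have -> : expR h - 1 - h + (1 + h) = expR h by ring.
  have := ler_normD 1 h; rewrite normr1; have := normr_ge0 h; nra.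
have E1 : `|expR h - 1| <= 2 * n.
  have := ler_normD (expR h - 1 - h) h; rewrite subrK.
  have := normr_ge0 h; nra.
apply: (le_trans (cmod_le_ReIm _)).
rewrite !cReB !cImB cReM cImM /= !mul0r !subr0 addr0.
have -> : expR h * cos k - 1 - h = expR h - 1 - h + expR h * (cos k - 1) by ring.
have -> : expR h * sin k - k = expR h * (sin k - k) + (expR h - 1) * k by ring.
have U := ler_normD (expR h - 1 - h) (expR h * (cos k - 1)).
have V := ler_normD (expR h * (sin k - k)) ((expR h - 1) * k).
rewrite !normrM in U V; apply: (le_trans (lerD U V)).
have Ac : `|expR h| * `|cos k - 1| <= 3 * (n * `|k|) by rewrite ler_pM.
have As : `|expR h| * `|sin k - k| <= 3 * (n * `|k|) by rewrite ler_pM.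
have Ak : `|expR h - 1| * `|k| <= 2 * n * `|k| by rewrite ler_wpM2r.
have nk : n * `|k| <= e / 8 * `|k| by rewrite ler_wpM2r.
have nh : n * `|h| <= e / 8 * `|h| by rewrite ler_wpM2r.
have : 0 <= e * `|h| by rewrite mulr_ge0// ltW.
by move: H1 Ac As Ak nk nh; clear; lra.
Qed.

(** The value c + exp (x + i t). *)
Definition log_polar (c : C) x t : C := c + (expR x)%:C%C * cis t.

Lemma log_polar_approx c x t e : 0 < e ->
  exists2 delta, 0 < delta & forall x' t', `|x' - x| < delta -> `|t' - t| < delta ->
  cmod (log_polar c x' t' - log_polar c x t -
        (expR x)%:C%C * cis t * ((x' - x) +i* (t' - t))%C)
  <= e * (`|x' - x| + `|t' - t|).
Proof.
move=> e0; have ex0 := expR_gt0 x.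
have [|delta d0 dP] := @cexp_approx0 (e / expR x); first by rewrite divr_gt0.
exists delta => // x' t' xd td; have := dP _ _ xd td.
rewrite -(ler_pM2l ex0) => H; apply: le_trans (le_trans H _); last first.
  by rewrite mulrA mulrCA mulfV ?mulr1// gt_eqF.
have -> : log_polar c x' t' - log_polar c x t -
      (expR x)%:C%C * cis t * ((x' - x) +i* (t' - t))%C =
    (expR x)%:C%C * cis t * ((expR (x' - x))%:C%C * cis (t' - t) - 1 -
      ((x' - x) +i* (t' - t))%C).
  rewrite /log_polar; have -> : expR x' = expR x * expR (x' - x) by rewrite -expRD subrKC.
  have -> : cis t' = cis t * cis (t' - t) by rewrite -cisD subrKC.
  have -> : (expR x * expR (x' - x))%:C%C = (expR x)%:C%C * (expR (x' - x))%:C%C :> C.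
    exact: rmorphM.
  move: ((expR x)%:C%C : C) ((expR (x' - x))%:C%C : C) ((x' - x) +i* (t' - t))%C => a b D.
  by move: (cis t) (cis (t' - t)) => u v; ring.
by rewrite !cmodM cmod_real cmod_cis mulr1 ger0_norm ?expR_ge0.
Qed.

(** The chain rule turns dF = a dz into m (dx + i dt) with m = a exp (x + i t); the
    coefficient Re m occurs both in d Im F / dt and in d Re F / dx. *)
Lemma log_polar_frechet2 F (c : C) x t : derivable F (log_polar c x t) 1 ->
  exists p q s,
    frechet2 (fun x t => complex.Im (F (log_polar c x t))) x t p q /\
    frechet2 (fun x t => complex.Re (F (log_polar c x t))) x t q s.
Proof.
move=> /cderivable_approx[a aP].
have [m mE] : exists m : C, m = a * ((expR x)%:C%C * cis t) by eexists.
exists (complex.Im m), (complex.Re m), (- complex.Im m).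
suff K e : 0 < e -> exists2 delta, 0 < delta & forall x' t',
    `|x' - x| < delta -> `|t' - t| < delta ->
    cmod (F (log_polar c x' t') - F (log_polar c x t) -
          m * ((x' - x) +i* (t' - t))%C) <= e * (`|x' - x| + `|t' - t|).
  split=> e /K[delta d0 dP]; exists delta => // x' t' xd td;
    apply: le_trans (dP _ _ xd td).
  - apply: le_trans (ler_Im _); rewrite !cImB cImM /=.
    rewrite le_eqVlt; apply/orP; left; apply/eqP; congr `|_|; ring.
  - apply: le_trans (ler_Re _); rewrite !cReB cReM /=.
    rewrite le_eqVlt; apply/orP; left; apply/eqP; congr `|_|; ring.
move=> e0.
set E : C := (expR x)%:C%C * cis t in mE.
pose k := cmod a + cmod E + 2; have k0 : 0 < k.
  by rewrite ltr_wpDl// addr_ge0// cmod_ge0.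
have [n [n0 nk n1]] : exists n : R, [/\ 0 < n, n * k <= e & n <= 1].
  exists (Num.min (e / k) 1); rewrite lt_min ltr01 divr_gt0//.
  by split; rewrite // -?ler_pdivlMr// ge_min lexx ?orbT.
have [d1 d10 d1P] := aP n n0.
have [d2 d20 d2P] := @log_polar_approx c x t n n0.
have K0 : 0 < 2 * (cmod E + 1) by rewrite mulr_gt0// ltr_wpDl// cmod_ge0.
exists (Num.min d2 (d1 / (2 * (cmod E + 1)))); first by rewrite lt_min d20 divr_gt0.
move=> x' t'; rewrite !lt_min => /andP[x2 x1] /andP[t2 t1].
have := d2P _ _ x2 t2; rewrite -/E.
set D : C := ((x' - x) +i* (t' - t))%C; set L := _ - log_polar c x t => H.
set S := `|x' - x| + `|t' - t| in H *.
have S0 : 0 <= S by rewrite addr_ge0.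
have DS : cmod D <= S by exact: cmod_le_ReIm.
have ES : cmod (E * D) <= cmod E * S by rewrite cmodM ler_wpM2l// cmod_ge0.
have LS : cmod L <= (cmod E + 1) * S.
  have := ler_cmodD (L - E * D) (E * D); rewrite subrK => HL.
  have : n * S <= 1 * S by rewrite ler_wpM2r.
  by rewrite mulrDl; lra.
have Ld : cmod L < d1.
  apply: (le_lt_trans LS).
  by rewrite ltr_pdivlMr// in x1; rewrite ltr_pdivlMr// in t1; rewrite /S; lra.
have := d1P (log_polar c x' t'); rewrite -/L => /(_ Ld) H1.
have -> : F (log_polar c x' t') - F (log_polar c x t) - m * D =
  (F (log_polar c x' t') - F (log_polar c x t) - a * L) + a * (L - E * D).
  by rewrite mE; ring.
apply: (le_trans (ler_cmodD _ _)); rewrite cmodM.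
apply: le_trans (_ : n * k * S <= _); last by rewrite ler_wpM2r.
have : n * cmod L <= n * ((cmod E + 1) * S) by rewrite ler_pM2l.
have : cmod a * cmod (L - E * D) <= cmod a * (n * S) by rewrite ler_wpM2l// cmod_ge0.
have : 0 <= n * S by rewrite mulr_ge0// ltW.
by rewrite /k; move: H1; clear; nra.
Qed.

End LogPolar.
(** * Maximum principles *)

Section MeanValue.
Context {R : realType}.
Notation C := (Cplx R).
Implicit Types (F H : C -> C) (c z w : C).

Lemma cmod_log_polar c (x t : R) : cmod (log_polar c x t - c) = expR x.
Proof. by rewrite /log_polar addrC addKr cmodM cmod_cis mulr1 cmod_real ger0_norm ?expR_ge0. Qed.

(** In the variables x = log |z - c| and t = arg (z - c) the Cauchy-Riemann
    equations say that Im F dx + Re F dt is closed, and the two horizontal sides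
    of the rectangle cancel by periodicity. *)
Lemma circle_mean_eq F c (a b : R) : a < b ->
  (forall w, expR a <= cmod (w - c) <= expR b -> derivable F w 1) ->
  segment_integral 0 (2 * pi)
    (fun t => complex.Re (F (log_polar c b t)) - complex.Re (F (log_polar c a t))) = 0.
Proof.
move=> ab dF; have p0 := pi_gt0 R.
have fF x t : a <= x <= b -> exists p q s,
    frechet2 (fun x t => complex.Im (F (log_polar c x t))) x t p q /\
    frechet2 (fun x t => complex.Re (F (log_polar c x t))) x t q s.
  by move=> xab; apply/log_polar_frechet2/dF; rewrite cmod_log_polar !ler_expR.
have := @goursat R (fun x t => complex.Im (F (log_polar c x t)))
  (fun x t => complex.Re (F (log_polar c x t))) a b 0 (2 * pi) ab.
rewrite mulr_gt0// => /(_ isT (fun x xab t _ => fF x t xab)).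
rewrite /rectangle_integral; set f := (f in segment_integral a b f).
have -> : f = fun=> 0.
  apply/funext => x; rewrite /f /log_polar.
  suff -> : cis (2 * pi) = cis 0 :> C by rewrite subrr.
  by rewrite /cis mulr_natl cos2pi sin2pi cos0 sin0.
by rewrite segment_integral_cst ?(ltW ab)// mul0r sub0r => /eqP; rewrite oppr_eq0 => /eqP.
Qed.

(** The mean of Re F over the circle of radius r / 2 would be at most
    Re F(c) - e (r / 2)^2, although it equals the means over arbitrarily small
    circles, which are close to Re F(c). *)
Lemma no_quadratic_max F c (r e : R) : 0 < r -> 0 < e ->
  (forall w, cmod (w - c) < r -> derivable F w 1) ->
  ~ (forall w, cmod (w - c) < r ->
       complex.Re (F w) <= complex.Re (F c) - e * cmod (w - c) ^+ 2).
Proof.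
move=> r0 e0 dF maxF; have p0 := pi_gt0 R.
have r2 : 0 < r / 2 by rewrite divr_gt0.
pose m := e * (r / 2) ^+ 2; have m0 : 0 < m by rewrite mulr_gt0// exprn_gt0.
have m2 : 0 < m / 2 by rewrite divr_gt0.
have /cvg_Re/cvgrPdist_le/(_ _ m2) : F w @[w --> c] --> F c.
  by apply/cderivable_continuous/dF; rewrite subrr cmod0.
move=> /nbhs_cmodP[delta d0 dP].
pose s := Num.min (delta / 2) (r / 4).
have s0 : 0 < s by rewrite lt_min !divr_gt0.
have sr : s <= r / 4 by rewrite ge_min lexx orbT.
have sd : s <= delta / 2 by rewrite ge_min lexx.
have ea : expR (ln s) = s by rewrite lnK.
have eb : expR (ln (r / 2)) = r / 2 by rewrite lnK.
have ab : ln s < ln (r / 2) by rewrite ltr_ln ?posrE//; lra.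
have dF' w : expR (ln s) <= cmod (w - c) <= expR (ln (r / 2)) -> derivable F w 1.
  by rewrite ea eb => wsr; apply: dF; lra.
have := circle_mean_eq ab dF'.
have cQ x : x <= ln (r / 2) -> continuous_on_segment 0 (2 * pi)
    (fun t => complex.Re (F (log_polar c x t))).
  move=> xr t _; have [|p [q [u [_ fQ]]]] := @log_polar_frechet2 R F c x t.
    apply: dF; rewrite cmod_log_polar.
    by rewrite -ler_expR eb in xr; lra.
  exact: (frechet2_continuous (frechet2_swap fQ)).
set I := segment_integral _ _ _ => I0.
have : I <= segment_integral 0 (2 * pi) (fun=> - (m / 2)).
  apply: le_segment_integral.
  - by move=> t tI; apply: cvgB; [exact: (cQ _ (lexx _))|exact: (cQ _ (ltW ab))].
  - by move=> t _; exact: cst_continuous.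
  - move=> t _; set wb := log_polar c _ t; set wa := log_polar c (ln s) t.
    have Hb : cmod (wb - c) = r / 2 by rewrite cmod_log_polar.
    have Ha : cmod (wa - c) = s by rewrite cmod_log_polar.
    have := maxF wb; rewrite Hb -/m => /(_ ltac:(lra)).
    have := dP wa; rewrite Ha => /(_ ltac:(lra)); rewrite /= ler_norml.
    move: (complex.Re _) (complex.Re _) (complex.Re _) => *; lra.
have pi2 : 0 <= 2 * pi :> R by rewrite mulr_ge0// ltW.
rewrite I0 segment_integral_cst// subr0.
have : 0 < m * pi by rewrite mulr_gt0.
lra.
Qed.

(** Asking for holomorphy only where H does not vanish allows H to be extended by 0
    to its singularities. The reason is the previous lemma, applied at an interior
    maximum z of |H| + e |w - c|^2 with H z nonzero: the rotation
    conj (H z) H / |H z| has real part at most |H|, and adding an affine term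
    turns |w - c|^2 into |w - z|^2. *)
Lemma rado_maximum_principle H c (r M : R) : 0 < r ->
  (forall w, cmod (w - c) <= r -> H x @[x --> w] --> H w) ->
  (forall w, cmod (w - c) < r -> H w != 0 -> derivable H w 1) ->
  (forall w, cmod (w - c) = r -> cmod (H w) <= M) ->
  forall w, cmod (w - c) <= r -> cmod (H w) <= M.
Proof.
move=> r0 cH dH bH w wr.
have M0 : 0 <= M.
  apply: le_trans (cmod_ge0 _) (bH (c + r%:C%C) _).
  by rewrite addrC addKr cmod_real ger0_norm// ltW.
apply/ler_addgt0Pr => e0 e00.
pose e := e0 / r ^+ 2; have e_gt0 : 0 < e by rewrite divr_gt0// exprn_gt0.
have er : e * r ^+ 2 = e0 by rewrite /e divfK// expf_neq0// gt_eqF.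
pose D := [set w : C | cmod (w - c) <= r].
pose g (x : C) := cmod (H x) + e * cmod (x - c) ^+ 2.
have cg : {within D, continuous g}.
  apply: continuous_in_subspaceT => x; rewrite inE => /cH cHx.
  have cH' := cvg_at_cmod cHx.
  have ce : (fun=> e) @ nbhs x --> e by exact: cvg_cst.
  have cx := @continuous_cmodB R c x.
  exact: (cvgD cH' (cvgM ce (cvgM cx cx))).
have [|z zD zmax] := compact_EVT_max _ (@compact_closed_disk R c r) cg.
  by exists c; rewrite /= subrr cmod0 ltW.
rewrite inE /= in zD.
have gM : g z <= M + e0.
  have zr : cmod (z - c) ^+ 2 <= r ^+ 2.
    by rewrite lerXn2r ?nnegrE ?cmod_ge0// ltW.
  have ezr : e * cmod (z - c) ^+ 2 <= e0 by rewrite -er ler_pM2l.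
  have [Hz0|Hz0] := eqVneq (H z) 0; first by rewrite /g Hz0 cmod0; lra.
  move: zD; rewrite le_eqVlt => /orP[/eqP zr'|zr'].
    by rewrite lerD// bH.
  exfalso.
  have nH : cmod (H z) != 0 by rewrite gt_eqF// cmod_gt0.
  have [d d0 dP] : exists2 d, 0 < d & forall x, cmod (x - z) < d ->
      cmod (x - c) < r /\ H x != 0.
    have Hz' : 0 < cmod (H z) by rewrite cmod_gt0.
    have /cvg_at_cmodP/(_ _ Hz')/nbhs_cmodP[d d0 dP] := cH z (ltW zr').
    exists (Num.min d (r - cmod (z - c))); first by rewrite lt_min d0 subr_gt0.
    move=> x; rewrite lt_min => /andP[/dP xd xr]; split.
      have := ler_cmodD (x - z) (z - c); rewrite addrA subrK; lra.
    apply/eqP => Hx; move: xd; rewrite /= Hx sub0r cmodN ltxx.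
    by [].
  (* The conjugate of H z, normalized. *)
  pose u : C := (complex.Re (H z) / cmod (H z) -i* (complex.Im (H z) / cmod (H z)))%C.
  have u1 : cmod u = 1.
    rewrite cmodE /= sqrrN !expr_div_n -mulrDl -sqr_cmod divff ?sqrtr1//.
    by rewrite expf_neq0.
  have uH : complex.Re (u * H z) = cmod (H z).
    rewrite cReM /= mulNr opprK [RHS](_ : _ = cmod (H z) ^+ 2 / cmod (H z)); last first.
      by rewrite expr2 mulfK.
    by rewrite sqr_cmod; field.
  (* With v = 2 e conj (z - c), the difference of e |x - c|^2 and e |x - z|^2 is
     Re (v (x - z)) up to a constant. *)
  pose v : C := (2 * e * complex.Re (z - c) -i* (2 * e * complex.Im (z - c)))%C.
  apply: (@no_quadratic_max (fun x => u * H x + v * (x - z)) z d e d0 e_gt0).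
    move=> x xd; have [xr Hx] := dP x xd.
    apply: cderivableD; first by apply: cderivableM; [exact: cderivable_cst|exact: dH].
    apply: cderivableM; first exact: cderivable_cst.
    by apply: cderivableB; [exact: cderivable_id|exact: cderivable_cst].
  move=> x xd; have [xr Hx] := dP x xd.
  rewrite !cReD subrr mulr0 /= uH addr0.
  have := zmax x; rewrite inE /= => /(_ (ltW xr)); rewrite /g !sqr_cmod.
  have : complex.Re (u * H x) <= cmod (H x).
    by rewrite -[X in _ <= X]mul1r -u1 -cmodM (le_trans _ (ler_Re _))// ler_norm.
  rewrite [complex.Re (v * _)]cReM !cReB !cImB /=.
  move: (complex.Re (u * _)) (cmod _) (cmod _) => *; nra.
apply: le_trans gM; apply: le_trans (zmax w _); last by rewrite inE.
by rewrite /g lerDl mulr_ge0 ?exprn_ge0 ?cmod_ge0 ?(ltW e_gt0).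
Qed.

(** The zeros of p stand for the singularities of F. The products F^N p extend
    continuously by 0 to them, and |F|^N |p| <= M^N max |p| gives |F| <= M as N grows. *)
Lemma punctured_maximum_principle F (p : C -> C) c (r M : R) : 0 < r -> 0 <= M ->
  (forall w, derivable p w 1) ->
  (forall w, cmod (w - c) <= r -> p w != 0 -> derivable F w 1) ->
  (forall w, cmod (w - c) <= r -> p w = 0 -> exists B : R,
     \forall x \near w, p x != 0 -> cmod (F x) <= B) ->
  (forall w, cmod (w - c) = r -> p w != 0 -> cmod (F w) <= M) ->
  forall w, cmod (w - c) <= r -> p w != 0 -> cmod (F w) <= M.
Proof.
move=> r0 M0 dp dF bF FM w wr pw.
have [P P0 pP] : exists2 P, 0 < P & forall x, cmod (x - c) = r -> cmod (p x) <= P.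
  have cp : {within [set w : C | cmod (w - c) <= r], continuous (fun x => cmod (p x))}.
    apply: continuous_in_subspaceT => x _.
    exact/cvg_at_cmod/cderivable_continuous.
  have [|z _ zmax] := compact_EVT_max _ (@compact_closed_disk R c r) cp.
    by exists c; rewrite /= subrr cmod0 ltW.
  exists (cmod (p z) + 1); first by rewrite ltr_wpDl// cmod_ge0.
  move=> x xr; rewrite (le_trans (zmax x _)) ?lerDl//.
  by rewrite inE /= xr.
have key N : cmod (F w) ^+ N * cmod (p w) <= M ^+ N * P.
  rewrite -cmodX -cmodM.
  apply: (@rado_maximum_principle (fun x => F x ^+ N * p x) c r) wr => //.
  - move=> x xr; have [px|px] := eqVneq (p x) 0; last first.
      by apply/cderivable_continuous/cderivableM; [apply/cderivableX/dF|exact: dp].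
    have [B0 B0P] := bF x xr px; pose B := Num.max B0 1.
    have B1 : 1 <= B by rewrite le_max lexx orbT.
    have B0' : 0 < B ^+ N by rewrite exprn_gt0//; lra.
    apply/cvg_at_cmodP => e e0; rewrite px mulr0.
    have eB : 0 < e / B ^+ N by rewrite divr_gt0.
    have /cvg_at_cmodP/(_ _ eB) := cderivable_continuous (dp x).
    apply: filterS2 B0P => y yB; rewrite px !subr0 => pye.
    have [->|py] := eqVneq (p y) 0; first by rewrite mulr0 cmod0.
    rewrite cmodM cmodX; apply: le_lt_trans (_ : B ^+ N * cmod (p y) < _).
      rewrite ler_wpM2r ?cmod_ge0// lerXn2r ?nnegrE ?cmod_ge0//; first by lra.
      by rewrite (le_trans (yB py))// le_max lexx.
    by rewrite mulrC -ltr_pdivlMr.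
  - move=> x /ltW xr; rewrite mulf_eq0 => /norP[_ px].
    by apply: cderivableM; [apply/cderivableX/dF|exact: dp].
  - move=> x xr; have [->|px] := eqVneq (p x) 0.
      by rewrite mulr0 cmod0 mulr_ge0 ?exprn_ge0// ltW.
    rewrite cmodM cmodX ler_pM ?exprn_ge0 ?cmod_ge0 ?pP//.
    by rewrite lerXn2r ?nnegrE ?cmod_ge0// FM.
have p0 : 0 < cmod (p w) by rewrite cmod_gt0.
rewrite leNgt; apply/negP => MF.
have F0 : 0 < cmod (F w) by exact: le_lt_trans MF.
pose q := M / cmod (F w).
have q1 : `|q| < 1 by rewrite ger0_norm ?divr_ge0 ?cmod_ge0// ltr_pdivrMr// mul1r.
have /cvgrPdist_lt/(_ (cmod (p w) / P)) := @cvg_expr R q q1.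
rewrite divr_gt0// => /(_ isT)[N _ /(_ N (leqnn N))]; rewrite /= sub0r normrN.
rewrite ger0_norm ?exprn_ge0 ?divr_ge0 ?cmod_ge0// expr_div_n.
rewrite ltr_pdivrMr ?exprn_gt0// mulrAC ltr_pdivlMr//.
by have := key N; rewrite [cmod (p w) * _]mulrC; lra.
Qed.

End MeanValue.
(** * Isolated singularities *)

Section IsolatedSingularity.
Context {R : realType}.
Notation C := (Cplx R).
Implicit Types (F f : C -> C) (a b c z w : C).

Lemma compact_lower_bound F (K : set C) : compact K ->
  (forall w, K w -> F x @[x --> w] --> F w) -> (forall w, K w -> F w != 0) ->
  exists2 m : R, 0 < m & forall w, K w -> m <= cmod (F w).
Proof.
move=> cK cF F0; have [K0|/set0P/negP] := pselect (K !=set0); last first.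
  by rewrite negbK => /eqP ->; exists 1.
have [|z zK zmin] := compact_EVT_min (f := fun x => cmod (F x)) K0 cK.
  apply: continuous_in_subspaceT => x; rewrite inE => /cF cFx.
  exact: cvg_at_cmod cFx.
exists (cmod (F z)); first by rewrite cmod_gt0 F0// -inE.
by move=> w Kw; apply: zmin; rewrite inE.
Qed.

Lemma compact_annulus c (r1 r2 : R) :
  compact [set w : C | r1 <= cmod (w - c) <= r2].
Proof.
apply: (subclosed_compact _ (@compact_closed_disk R c r2)); last by move=> w /= /andP[].
have cg := @continuous_cmodB R c.
have -> : [set w : C | r1 <= cmod (w - c) <= r2] =
    (fun w => cmod (w - c)) @^-1` ([set x | r1 <= x] `&` [set x | x <= r2]).
  by apply/seteqP; split => w /=; [move=> /andP|move=> [-> ->]].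
apply: closed_comp => [w _|]; first exact: cg.
by apply: closedI; [exact: closed_ge|exact: closed_le].
Qed.

Lemma dnbhs_point c (P : set C) (r : R) : 0 < r -> c^' P ->
  exists w, [/\ w != c, cmod (w - c) < r & P w].
Proof.
move=> r0 /dnbhs_cmodP[d d0 dP].
pose s := Num.min r d / 2.
have s0 : 0 < s by rewrite divr_gt0// lt_min r0.
have [sr sd] : s < r /\ s < d.
  have : Num.min r d <= r by rewrite ge_min lexx.
  have : Num.min r d <= d by rewrite ge_min lexx orbT.
  by move: s0; rewrite /s; split; lra.
have E : cmod (c + s%:C%C - c) = s by rewrite addrC addKr cmod_real gtr0_norm.
have nc : c + s%:C%C != c by rewrite -subr_eq0 -cmod_gt0 E.
by exists (c + s%:C%C); split; rewrite // ?E//; apply: dP => //; rewrite E.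
Qed.

(** The function 1 / (F - v) cannot be holomorphic on the punctured disk when v
    is closer to w0 than half the distance of w0 to the image of the boundary:
    the maximum principle would bound it by 2 / m, where m is that distance, and
    v would be at distance at least m / 2 from the limit w0. *)
Lemma open_mapping F c w0 (r : R) : 0 < r ->
  (forall w, w != c -> cmod (w - c) <= r -> derivable F w 1) ->
  F x @[x --> c^'] --> w0 ->
  (forall w, cmod (w - c) = r -> F w != w0) ->
  exists2 d : R, 0 < d & forall v, v != w0 -> cmod (v - w0) < d ->
    exists z, [/\ z != c, cmod (z - c) < r & F z = v].
Proof.
move=> r0 dF Fw0 nF.
have nc w : cmod (w - c) = r -> w != c by rewrite -subr_eq0 -cmod_gt0 => ->.
have [m m0 mP] : exists2 m : R, 0 < m &
    forall w, cmod (w - c) = r -> m <= cmod (F w - w0).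
  have [||m m0 mP] := @compact_lower_bound (fun x => F x - w0) _ (@compact_annulus c r r).
  - move=> w /andP[rw wr]; apply: cderivable_continuous.
    apply: cderivableB; last exact: cderivable_cst.
    by apply: dF => //; apply: nc; apply/eqP; rewrite eq_le wr.
  - by move=> w /andP[rw wr]; rewrite subr_eq0 nF//; apply/eqP; rewrite eq_le wr.
  by exists m => // w wr; apply: mP; rewrite /= wr lexx.
exists (m / 2); first by rewrite divr_gt0.
move=> v vw0 vm; apply: contrapT => nz.
have Fv x : x != c -> cmod (x - c) <= r -> F x != v.
  move=> xc; rewrite le_eqVlt => /orP[/eqP xr|xr]; apply/eqP => Fxv.
    by have := mP x xr; rewrite Fxv; lra.
  by apply: nz; exists x.
have vw : 0 < cmod (w0 - v) by rewrite cmod_gt0 subr_eq0 eq_sym.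
have G x : cmod (x - c) <= r -> x - c != 0 -> cmod (F x - v)^-1 <= 2 / m.
  apply: (@punctured_maximum_principle R (fun x => (F x - v)^-1) (fun x => x - c)
    c r (2 / m) r0).
  - by rewrite divr_ge0// ltW.
  - by move=> w; apply: cderivableB; [exact: cderivable_id|exact: cderivable_cst].
  - move=> w wr; rewrite subr_eq0 => wc; apply: cderivableV; first by rewrite subr_eq0 Fv.
    by apply: cderivableB; [exact: dF|exact: cderivable_cst].
  - move=> w _ /eqP; rewrite subr_eq0 => /eqP ->.
    exists (2 / cmod (w0 - v)).
    have vw2 : 0 < cmod (w0 - v) / 2 by rewrite divr_gt0.
    move/cvg_punctured_cmodP: Fw0 => /(_ _ vw2)[d d0 dP].
    apply/nbhs_cmodP; exists d => // y yd; rewrite subr_eq0 => yc.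
    have := dP y yc yd => Fy.
    rewrite cmodV -[2 / _]invf_div lef_pV2 ?posrE ?divr_gt0//; last first.
      have := ler_cmodD (w0 - F y) (F y - v); rewrite addrA subrK (cmodB w0 (F y)).
      by move: vw Fy; clear; lra.
    have := ler_cmodD (w0 - F y) (F y - v); rewrite addrA subrK (cmodB w0 (F y)).
    by move: Fy; clear; lra.
  - move=> w wr _; rewrite cmodV -[2 / m]invf_div.
    have Fm : m / 2 <= cmod (F w - v).
      have := ler_cmodD (F w - v) (v - w0); rewrite addrA subrK.
      by have := mP w wr; lra.
    by rewrite lef_pV2 ?posrE ?divr_gt0//; apply: lt_le_trans Fm; rewrite divr_gt0.
have gap : 0 < m / 2 - cmod (v - w0) by lra.
move/cvg_punctured_cmodP: Fw0 => /(_ _ gap)/dnbhs_cmodP H.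
have [x [xc xr Fx]] := dnbhs_point r0 H.
have := G x (ltW xr); rewrite subr_eq0 => /(_ xc).
have Fxv : 0 < cmod (F x - v) by rewrite cmod_gt0 subr_eq0 Fv// ltW.
rewrite cmodV -[2 / m]invf_div lef_pV2 ?posrE ?divr_gt0//.
have := ler_cmodD (F x - w0) (w0 - v); rewrite addrA subrK (cmodB w0 v).
lra.
Qed.

(** The difference quotient of F at w is bounded on the circle of radius r / 2
    uniformly in w, hence on the whole disk by the maximum principle with
    singularities 0 and w. *)
Lemma bounded_lipschitz F (r B : R) : 0 < r ->
  (forall w, w != 0 -> cmod w < r -> derivable F w 1) ->
  (forall w, w != 0 -> cmod w < r -> cmod (F w) <= B) ->
  exists2 K : R, 0 < K & forall z w, z != 0 -> w != 0 ->
    cmod z < r / 4 -> cmod w < r / 4 -> cmod (F z - F w) <= K * cmod (z - w).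
Proof.
move=> r0 dF FB.
have B0 : 0 <= B.
  have s : cmod ((r / 2)%:C%C : C) = r / 2 by rewrite cmod_real gtr0_norm// divr_gt0.
  have s0 : ((r / 2)%:C%C : C) != 0 by rewrite -cmod_gt0 s divr_gt0.
  by apply: le_trans (cmod_ge0 _) (FB _ s0 _); rewrite s; lra.
have r4 : 0 < r / 4 by rewrite divr_gt0.
(* A point of the circle of radius r / 2 is at distance at least r / 4 from w. *)
exists (2 * (B + 1) / (r / 4)); first by rewrite divr_gt0//; lra.
move=> z w z0 w0 zr wr.
have [->|zw] := eqVneq z w; first by rewrite !subrr cmod0 mulr0.
have zw0 : z - w != 0 by rewrite subr_eq0.
rewrite -ler_pdivrMr ?cmod_gt0// -cmodV -cmodM.
pose p (x : C) : C := x * (x - w).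
have pP x : p x != 0 -> x != 0 /\ x - w != 0 by rewrite mulf_eq0 => /norP.
have dxw x : derivable (fun x : C => x - w : C) x 1.
  by apply: cderivableB; [exact: cderivable_id|exact: cderivable_cst].
have r2 : 0 < r / 2 by lra.
apply: (@punctured_maximum_principle R (fun x => (F x - F w) * (x - w)^-1) p 0 (r / 2)
  _ r2).
- by rewrite divr_ge0// ?ltW//; lra.
- by move=> x; apply: cderivableM; [exact: cderivable_id|exact: dxw].
- move=> x xr /pP[x0 xw]; rewrite subr0 in xr.
  apply: cderivableM; last by apply: cderivableV.
  by apply: cderivableB; [apply: dF => //; lra|exact: cderivable_cst].
- move=> x; rewrite subr0 => xr /eqP; rewrite mulf_eq0 => /orP[/eqP->|].
    exists ((B + B) / (cmod w / 2)).
    have w2 : 0 < cmod w / 2 by rewrite divr_gt0// cmod_gt0.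
    apply/nbhs_cmodP; exists (Num.min (cmod w / 2) r); first by rewrite lt_min w2.
    move=> y; rewrite subr0 lt_min => /andP[yw yr] /pP[y0 yw0].
    rewrite cmodM cmodV ler_pM ?invr_ge0 ?cmod_ge0//.
      have := ler_cmodB (F y) (F w); have := FB y y0 yr; have := FB w w0 ltac:(lra).
      by clear; lra.
    rewrite lef_pV2 ?posrE// ?cmod_gt0//.
    by have := ler_cmod_dist w y; rewrite (cmodB w); lra.
  rewrite subr_eq0 => /eqP ->.
  have [a aP] := cderivable_approx (dF w w0 ltac:(lra)).
  have [d d0 dP] := aP 1 ltr01.
  exists (cmod a + 1); apply/nbhs_cmodP; exists d => // y yd /pP[y0 yw].
  rewrite cmodM cmodV ler_pdivrMr ?cmod_gt0//.
  have := dP y yd; have := ler_cmodD (F y - F w - a * (y - w)) (a * (y - w)).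
  by rewrite subrK cmodM mulrDl; lra.
- move=> x; rewrite subr0 => xr /pP[x0 xw].
  rewrite cmodM cmodV ler_pM ?invr_ge0 ?cmod_ge0//.
    have := ler_cmodB (F x) (F w); have := FB x x0; have := FB w w0; lra.
  rewrite lef_pV2 ?posrE// ?cmod_gt0//.
  by have := ler_cmod_dist x w; lra.
- by rewrite subr0; lra.
- by rewrite /p mulf_neq0.
Qed.

(** By compactness F has a cluster value at 0, and the Lipschitz bound turns it into a
    limit, reached at a linear rate; this rate makes (F - a) / x bounded again. *)
Lemma removable_singularity F (r B : R) : 0 < r ->
  (forall w, w != 0 -> cmod w < r -> derivable F w 1) ->
  (forall w, w != 0 -> cmod w < r -> cmod (F w) <= B) ->
  exists a, F x @[x --> (0 : C)^'] --> a /\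
    exists2 K : R, 0 < K & forall x, x != 0 -> cmod x < r / 4 ->
      cmod (F x - a) <= K * cmod x.
Proof.
move=> r0 dF FB; have [K K0 lipF] := bounded_lipschitz r0 dF FB.
have r4 : 0 < r / 4 by rewrite divr_gt0.
have [a [_ aP]] : exists a, [set w | cmod (w - 0) <= B] a /\ cluster (F @ (0 : C)^') a.
  apply: (@compact_closed_disk R 0 B); apply/dnbhs_cmodP; exists r => // w w0.
  by rewrite subr0 => wr; rewrite /= subr0; exact: FB.
have Fa : F x @[x --> (0 : C)^'] --> a.
  apply/cvg_punctured_cmodP => e e0.
  pose s := Num.min (r / 4) (e / (4 * K)).
  have s0 : 0 < s by rewrite lt_min r4 divr_gt0// mulr_gt0.
  have sr : s <= r / 4 by rewrite ge_min lexx.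
  have sK : K * s <= e / 4.
    have : s <= e / (4 * K) by rewrite ge_min lexx orbT.
    by rewrite ler_pdivlMr ?mulr_gt0//; lra.
  have [|| _ [[x [x0 xs] <-] /= Fxa]] :=
      aP (F @` [set x | x != 0 /\ cmod x < s]) [set w | cmod (w - a) < e / 2].
  - by apply/dnbhs_cmodP; exists s => // x x0; rewrite subr0 => xs; exists x.
  - by apply/nbhs_cmodP; exists (e / 2) => //; rewrite divr_gt0.
  exists s => // y y0; rewrite subr0 => ys.
  have := lipF y x y0 x0 ltac:(lra) ltac:(lra).
  have := ler_cmodD (F y - F x) (F x - a); rewrite addrA subrK.
  have : K * cmod (y - x) <= K * (s + s).
    rewrite ler_pM2l// (le_trans (ler_cmodB _ _))//; lra.
  lra.
exists a; split => //; exists K => // x x0 xr.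
apply/ler_addgt0Pr => e e0.
have e2 : 0 < e / 2 by rewrite divr_gt0.
move/cvg_punctured_cmodP: (Fa) => /(_ _ e2)/dnbhs_cmodP H.
have sK : 0 < Num.min (r / 4) (e / 2 / K) by rewrite lt_min r4 divr_gt0.
have [y [y0]] := dnbhs_point sK H.
rewrite subr0 lt_min => /andP[yr]; rewrite ltr_pdivlMr// => yK Fya.
have := lipF x y x0 y0 xr yr; have := ler_cmodD (F x - F y) (F y - a).
rewrite addrA subrK.
have : K * cmod (x - y) <= K * (cmod x + cmod y) by rewrite ler_pM2l// ler_cmodB.
lra.
Qed.

(** If no quotient F / x^k had a nonzero limit, all of them would be bounded, by
    B / rho^k according to the maximum principle on the disk of radius rho = r / 2,
    and F would vanish identically on that disk. *)
Lemma zero_order F (r B : R) : 0 < r ->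
  (forall w, w != 0 -> cmod w < r -> derivable F w 1) ->
  (forall w, w != 0 -> cmod w < r -> cmod (F w) <= B) ->
  (forall w, w != 0 -> cmod w < r -> F w != 0) ->
  exists (k : nat) b, b != 0 /\ (fun x => F x / x ^+ k) @ (0 : C)^' --> b.
Proof.
move=> r0 dF FB F0; apply: contrapT => noorder.
pose rho := r / 2; have rho0 : 0 < rho by rewrite divr_gt0.
have rhor : rho < r by rewrite /rho; lra.
have B0 : 0 <= B.
  have s : cmod (rho%:C%C : C) = rho by rewrite cmod_real gtr0_norm.
  have s0 : (rho%:C%C : C) != 0 by rewrite -cmod_gt0 s.
  by apply: le_trans (cmod_ge0 _) (FB _ s0 _); rewrite s.
have dk k w : w != 0 -> cmod w < r -> derivable (fun x => F x / x ^+ k : C) w 1.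
  move=> w0 wr; apply: cderivableM; first exact: dF.
  by apply: cderivableV; [rewrite expf_neq0|apply/cderivableX/cderivable_id].
have bk k : forall x, x != 0 -> cmod x <= rho -> cmod (F x / x ^+ k) <= B / rho ^+ k.
  elim: k => [|k IH] x x0 xr.
    by rewrite !expr0 !divr1 FB// (le_lt_trans xr).
  have [a [Fa [K K0 aK]]] := @removable_singularity (fun x => F x / x ^+ k) rho
    (B / rho ^+ k) rho0 (fun w nw wr => dk k w nw (lt_trans wr rhor))
    (fun w nw wr => IH w nw (ltW wr)).
  have a0 : a = 0 by apply/eqP/negPn/negP => a0; apply: noorder; exists k, a.
  apply: (@punctured_maximum_principle R (fun x => F x / x ^+ k.+1) (fun x => x) 0 rho
    _ rho0).
  - by rewrite divr_ge0// exprn_ge0// ltW.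
  - exact: cderivable_id.
  - by move=> w; rewrite subr0 => wr w0; apply: dk => //; exact: le_lt_trans rhor.
  - move=> w _ ->; exists K; apply/nbhs_cmodP; exists (rho / 4); first by rewrite divr_gt0.
    move=> y; rewrite subr0 => yr y0; have := aK y y0 yr; rewrite a0 subr0.
    by rewrite -ler_pdivrMr ?cmod_gt0// -cmodV -cmodM exprSr invfM mulrA mulrAC.
  - move=> w; rewrite subr0 => wr w0; have := IH w w0; rewrite wr => /(_ (lexx _)) H.
    have -> : F w / w ^+ k.+1 = F w / w ^+ k / w by rewrite exprSr invfM mulrA.
    have -> : B / rho ^+ k.+1 = B / rho ^+ k / rho by rewrite exprSr invfM mulrA.
    rewrite cmodM cmodV wr.
    by rewrite ler_wpM2r// invr_ge0 ltW.
  - by rewrite subr0.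
  - by [].
pose x : C := (rho / 2)%:C%C.
have xE : cmod x = rho / 2 by rewrite cmod_real gtr0_norm// divr_gt0.
have x0 : x != 0 by rewrite -cmod_gt0 xE divr_gt0.
have xr : cmod x <= rho by rewrite xE; lra.
have Fx0 : 0 < cmod (F x) by rewrite cmod_gt0 F0// (le_lt_trans xr).
have key k : cmod (F x) * 2 ^+ k <= B.
  have := bk k x x0 xr; rewrite cmodM cmodV cmodX xE expr_div_n invf_div mulrA.
  by rewrite ler_pM2r// invr_gt0 exprn_gt0.
have := upper_nthrootP (leqnn (Num.bound (B / cmod (F x)))).
by rewrite ltr_pdivrMr// mulrC ltNge key.
Qed.

End IsolatedSingularity.
(** * Winding along small circles *)

Section Winding.
Context {R : realType}.
Notation C := (Cplx R).
Implicit Types (t x : R) (g : R -> C).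

Definition circle (rho : R) t : C := rho%:C%C * cis (2 * pi * t).

Lemma cmod_circle rho t : 0 < rho -> cmod (circle rho t) = rho.
Proof. by move=> rho0; rewrite cmodM cmod_cis mulr1 cmod_real gtr0_norm. Qed.

Lemma circle_neq0 rho t : 0 < rho -> circle rho t != 0.
Proof. by move=> rho0; rewrite -cmod_gt0 cmod_circle. Qed.

Lemma closed_curve_circle rho : 0 < rho < 1 ->
  closed_curve (annulus 0) (circle rho).
Proof.
move=> /andP[rho0 rho1]; split.
- apply: continuous_subspaceT => t.
  have cl : (fun s : R => 2 * pi * s) @ t --> 2 * pi * t.
    by apply: cvgM; [exact: cvg_cst|exact: cvg_id].
  have cc : (fun s : R => cos (2 * pi * s)) @ t --> cos (2 * pi * t).
    exact: (cvg_comp _ _ cl (@continuous_cos R _)).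
  have cs : (fun s : R => sin (2 * pi * s)) @ t --> sin (2 * pi * t).
    exact: (cvg_comp _ _ cl (@continuous_sin R _)).
  apply: (@cvg_ReIm R R (nbhs t) (nbhs_filter t)) => /=.
    under eq_fun do rewrite mul0r subr0.
    rewrite mul0r subr0; apply: cvgM; [exact: cvg_cst|exact: cc].
  under eq_fun do rewrite mul0r addr0.
  by rewrite mul0r addr0; apply: cvgM; [exact: cvg_cst|exact: cs].
- move=> t _; rewrite /annulus /= ltc_normE' -(_ : (1 : R)%:C%C = 1)//.
  by rewrite ltc_normE cmod_circle// rho0 rho1.
- by rewrite /circle mulr0 mulr1 /cis mulr_natl cos2pi sin2pi cos0 sin0.
Qed.

(** By the intermediate value theorem, psi would otherwise reach psi 0 + pi / 2 or
    psi 0 - pi / 2. *)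
Lemma lift_trivial (psi : R -> R) (k : int) : {within `[0, 1], continuous psi} ->
  (forall t, 0 <= t <= 1 -> 0 < cos (psi t - psi 0)) ->
  psi 1 - psi 0 = 2 * pi * k%:~R -> k = 0.
Proof.
move=> cpsi psi0 psi1; have p0 := pi_gt0 R.
have noval s : cos s = 0 -> Num.min (psi 0) (psi 1) <= psi 0 + s ->
    psi 0 + s <= Num.max (psi 0) (psi 1) -> False.
  move=> s0 s1 s2.
  have [|t t01 tE] := IVT (@ler01 R) cpsi (v := psi 0 + s); first by rewrite s1.
  by have := psi0 t t01; rewrite tE addrC addKr s0 ltxx.
apply/eqP/negPn/negP => k0.
have [kp|kn|kE] := ltrgtP k 0; last by rewrite kE eqxx in k0.
- have : (k%:~R : R) <= -1 by rewrite -[-1]/((-1)%:~R) ler_int; lia.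
  move=> k1; have pk : 2 * pi * k%:~R <= - 2 * pi :> R by nra.
  apply: (noval (- (pi / 2))); first by rewrite cosN cos_pihalf.
    by rewrite ge_min; apply/orP; right; lra.
  by rewrite le_max; apply/orP; left; lra.
- have : (1 <= k%:~R :> R) by rewrite -[1]/(1%:~R) ler_int; lia.
  move=> k1; have pk : 2 * pi <= 2 * pi * k%:~R :> R by nra.
  apply: (noval (pi / 2)); first by rewrite cos_pihalf.
    by rewrite ge_min; apply/orP; left; lra.
  by rewrite le_max; apply/orP; right; lra.
Qed.

Lemma index_circle rho : 0 < rho < 1 -> index0 (circle rho) = 1.
Proof.
move=> rho01; have rho0 : 0 < rho by case/andP: rho01.
have w1 : winding (circle rho) 1.
  exists (fun t => 2 * pi * t); split.
  - apply: continuous_subspaceT => t.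
    by apply: cvgM; [exact: cvg_cst|exact: cvg_id].
  - move=> t _; split; first exact: circle_neq0.
    by rewrite normE cmod_circle.
  - by rewrite mulr0 subr0.
have [th [cth thE th1]] : winding (circle rho) (index0 (circle rho)).
  exact: (xgetPex 0 (ex_intro _ 1 w1)).
have cisE t : 0 <= t <= 1 -> cis (th t) = cis (2 * pi * t) :> C.
  move=> /thE[_]; rewrite normE cmod_circle// => H.
  have r0 : (rho%:C%C : C) != 0 by rewrite -cmod_gt0 cmod_real normr_gt0 gt_eqF.
  by apply: (mulfI r0); rewrite -/(circle rho t) H.
apply/eqP; rewrite -subr_eq0; apply/eqP.
apply: (@lift_trivial (fun t => th t - 2 * pi * t)).
- move=> t; apply: cvgB; first exact: cth.
  have : continuous (fun t => 2 * pi * t : R).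
    by move=> s; apply: cvgM; [exact: cvg_cst|exact: cvg_id].
  by move=> /continuous_subspaceT; apply.
- move=> t t01; have t00 : 0 <= (0 : R) <= 1 by rewrite lexx ler01.
  have E s : 0 <= s <= 1 -> cos (th s - 2 * pi * s) = 1 /\ sin (th s - 2 * pi * s) = 0.
    move=> /cisE[c1 s1]; rewrite cosB sinB c1 s1 -!expr2 cos2Dsin2.
    by split=> //; rewrite mulrC subrr.
  have [c1 s1] := E t t01; have [c0 s0] := E 0 t00.
  by rewrite cosB c1 c0 s1 s0 !mulr1 mulr0 addr0 ltr01.
- by rewrite mulr0 subr0 mulr1 rmorphB /= mulrBr mulr1 -th1; ring.
Qed.

Lemma cos_gt0_close (A B a b : R) : 0 < A -> 0 < B ->
  cmod (A%:C%C * cis a - B%:C%C * cis b : C) < B -> 0 < cos (a - b).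
Proof.
move=> A0 B0 H.
have : cmod (A%:C%C * cis a - B%:C%C * cis b : C) ^+ 2 < B ^+ 2.
  by rewrite ltrXn2r ?nnegrE ?cmod_ge0// ltW.
rewrite sqr_cmod cReB cImB !cReM !cImM /= !mul0r !subr0 !addr0.
have -> : (A * cos a - B * cos b) ^+ 2 + (A * sin a - B * sin b) ^+ 2 =
  A ^+ 2 * (cos a ^+ 2 + sin a ^+ 2) + B ^+ 2 * (cos b ^+ 2 + sin b ^+ 2)
   - 2 * A * B * (cos a * cos b + sin a * sin b) by ring.
rewrite !cos2Dsin2 -cosB !mulr1 => H2.
have A2 : 0 < A ^+ 2 by rewrite exprn_gt0.
have : 0 < (A * B) * cos (a - b) by move: H2 A2; clear; lra.
by rewrite pmulr_rgt0// mulr_gt0.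
Qed.

Lemma near_each_other (a u v : C) : cmod (u - a) < cmod a / 4 ->
  cmod (v - a) < cmod a / 4 -> cmod (v - u) < cmod u.
Proof.
have := ler_cmodD (v - a) (a - u); rewrite addrA subrK (cmodB a u).
have := ler_cmod_dist a u; rewrite (cmodB a u); have := cmod_ge0 (u - a).
by move: (cmod a) (cmod u) (cmod (u - a)) (cmod (v - a)) (cmod (v - u)) => *; lra.
Qed.

Lemma cisXz t (n : int) : cis t ^ n = cis (n%:~R * t) :> C.
Proof.
have cisXn m : cis t ^+ m = cis (m%:R * t) :> C.
  elim: m => [|m IH].
    by rewrite expr0 mul0r; apply: complex_ext; rewrite /= ?cos0 ?sin0.
  by rewrite exprS IH -cisD -{1}(mul1r t) -mulrDl -(natrD _ 1 m).
case: n => m; first by rewrite -exprnP cisXn.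
rewrite NegzE -exprnN cisXn rmorphN /= mulNr.
have cn0 : cis (m.+1%:R * t) != 0 :> C by rewrite -cmod_gt0 cmod_cis.
apply: (mulfI cn0); rewrite divff// -cisD subrr.
by apply: complex_ext; rewrite /= ?cos0 ?sin0.
Qed.

(** The exponent n may be negative, so that poles and zeros are treated alike. If f
    turns once around 0 along every small circle, then x ^ n f(x) turns n + 1 times,
    whereas a function with a nonzero limit does not turn at all. *)
Lemma winding_limit (f : C -> C) (n : int) (a : C) : a != 0 ->
  (forall rho : R, 0 < rho < 1 -> winding (f \o circle rho) 1) ->
  (fun x : C => f x * x ^ n) @ (0 : C)^' --> a -> n = -1.
Proof.
move=> a0 wf; have a1 : 0 < cmod a / 4 by rewrite divr_gt0// cmod_gt0.
move=> /cvg_punctured_cmodP/(_ _ a1)[d d0 dP].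
pose rho : R := Num.min (d / 2) (1 / 2).
have rho0 : 0 < rho by rewrite lt_min !divr_gt0.
have rho1 : rho < 1.
  by have : rho <= 1 / 2 by [rewrite ge_min lexx orbT]; lra.
have rhod : rho < d by have : rho <= d / 2 by [rewrite ge_min lexx]; lra.
have [th [cth thE th1]] := wf rho ltac:(by rewrite rho0 rho1).
have hP t : cmod (f (circle rho t) * circle rho t ^ n - a) < cmod a / 4.
  by apply: dP; [exact: circle_neq0|rewrite subr0 cmod_circle].
have hE t : 0 <= t <= 1 -> exists2 A, 0 < A &
    f (circle rho t) * circle rho t ^ n = A%:C%C * cis (th t + n%:~R * (2 * pi * t)).
  move=> /thE[/= f0]; rewrite normE => fE.
  exists (cmod (f (circle rho t)) * rho ^ n).
    by rewrite mulr_gt0 ?exprz_gt0// cmod_gt0.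
  rewrite {1}fE expfzMl cisXz -/(cis (th t)) cisD.
  have -> : (rho%:C%C : C) ^ n = (rho ^ n)%:C%C by rewrite -(fmorphXz (real_complex R)).
  have -> : (cmod (f (circle rho t)) * rho ^ n)%:C%C =
    (cmod (f (circle rho t)))%:C%C * (rho ^ n)%:C%C :> C by exact: rmorphM.
  ring.
have cm : continuous (fun t : R => n%:~R * (2 * pi * t) : R).
  move=> s; apply: cvgM; first exact: cvg_cst.
  by apply: cvgM; [exact: cvg_cst|exact: cvg_id].
apply/eqP; rewrite -subr_eq0 opprK; apply/eqP.
apply: (@lift_trivial (fun t => th t + n%:~R * (2 * pi * t))).
- move=> t; apply: cvgD; first exact: cth.
  by move: cm => /continuous_subspaceT; apply.
- move=> t t01; have t00 : 0 <= (0 : R) <= 1 by rewrite lexx ler01.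
  have [A A0 AE] := hE t t01; have [B B0 BE] := hE 0 t00.
  apply: (cos_gt0_close A0 B0); rewrite -AE -BE.
  have BM : cmod (f (circle rho 0) * circle rho 0 ^ n) = B.
    by rewrite BE cmodM cmod_cis mulr1 cmod_real gtr0_norm.
  by rewrite -[ltRHS]BM; exact: near_each_other.
- have i1 : 1%:~R = 1 :> R by [].
  have -> : th 1 = th 0 + 2 * pi by move: th1; rewrite i1; lra.
  by rewrite intrD i1; ring.
Qed.

End Winding.

(** * Univalent functions on the punctured disk *)

Section SimpleZero.
Context {R : realType}.
Notation C := (Cplx R).
Implicit Types (f : C -> C) (z w : C).

Lemma cderivable_cvg_punctured f z : derivable f z 1 -> f w @[w --> z^'] --> f z.
Proof.
by move=> df U fU; exact: (@nbhs_dnbhs _ z (f @^-1` U) (cderivable_continuous df fU)).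
Qed.

Lemma cvg_punctured_eq f g (r : R) z (a : C) : 0 < r ->
  (forall w, w != z -> cmod (w - z) < r -> g w = f w) ->
  f w @[w --> z^'] --> a -> g w @[w --> z^'] --> a.
Proof.
move=> r0 fg /cvg_punctured_cmodP fa; apply/cvg_punctured_cmodP => e /fa[d d0 dP].
exists (Num.min d r); first by rewrite lt_min d0.
by move=> w wz; rewrite lt_min => /andP[wd wr]; rewrite fg// dP.
Qed.

(** The values of f near 1/2 are avoided near 0, because f is injective and open;
    thus 1 / (f - f(1/2)) is bounded near 0, and f has at worst a pole there. The
    order of f at 0 is its index along small circles, hence 1. *)
Lemma univalent_simple_zero f :
  (forall w, w != 0 -> cmod w < 1 -> derivable f w 1) ->
  (forall z w, z != 0 -> w != 0 -> cmod z < 1 -> cmod w < 1 -> f z = f w -> z = w) ->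
  (forall w, w != 0 -> cmod w < 1 -> f w != 0) ->
  (forall rho : R, 0 < rho < 1 -> winding (f \o circle rho) 1) ->
  exists b, b != 0 /\ (fun x => f x / x) @ (0 : C)^' --> b.
Proof.
move=> df injf f0 wf.
(* The disks of radius 1/4 around h = 1/2 and around 0 are disjoint. *)
pose h : C := (1 / 2 : R)%:C%C.
have hE : cmod h = 1 / 2 by rewrite cmod_real gtr0_norm// divr_gt0.
have near_h w : cmod (w - h) <= 1 / 4 -> 1 / 4 <= cmod w <= 3 / 4.
  move=> wh; have := ler_cmod_dist h w; have := ler_cmodD (w - h) h.
  by rewrite subrK (cmodB h w) hE; lra.
have nz w : 0 < cmod w -> w != 0 by rewrite cmod_gt0.
have h0 : h != 0 by apply: nz; rewrite hE; lra.
have h1 : cmod h < 1 by rewrite hE; lra.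
have r4 : (0 : R) < 1 / 4 by lra.
have [|||d d0 dP] := @open_mapping R f h (f h) (1 / 4) r4.
- by move=> w _ /near_h/andP[w1 w2]; apply: df; [apply: nz|]; lra.
- by apply: cderivable_cvg_punctured; exact: df.
- move=> w wh; apply/eqP => fwh; move: (wh).
  have /near_h/andP[w1 w2] : cmod (w - h) <= 1 / 4 by rewrite wh.
  rewrite (injf w h)// ?subrr ?cmod0; [lra|by apply: nz; lra|lra].
have away w : w != 0 -> cmod w < 1 / 4 -> d <= cmod (f w - f h).
  move=> w0 w4; rewrite leNgt; apply/negP => fwd.
  have w1 : cmod w < 1 by lra.
  have [fwh|fwh] := eqVneq (f w) (f h).
    by have := injf w h w0 h0 w1 h1 fwh => E; move: w4; rewrite E hE; lra.
  have [z [_ /ltW/near_h/andP[z1 z2] fz]] := dP _ fwh fwd.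
  have : z = w by apply: injf => //; [apply: nz|]; lra.
  by move=> E; move: w4; rewrite -E; lra.
have fh0 w : w != 0 -> cmod w < 1 / 4 -> f w - f h != 0.
  by move=> w0 w4; apply: nz; apply: lt_le_trans (away w w0 w4).
have dfh w : w != 0 -> cmod w < 1 / 4 -> derivable (fun x => f x - f h : C) w 1.
  move=> w0 w4; apply: cderivableB; last exact: cderivable_cst.
  by apply: df => //; lra.
have [|||k [b [b0 kb]]] := @zero_order R (fun x => (f x - f h)^-1) (1 / 4) d^-1 r4.
- by move=> w w0 w4; apply: cderivableV; [exact: fh0|exact: dfh].
- move=> w w0 w4; rewrite cmodV lef_pV2 ?posrE//; first exact: away.
  by apply: lt_le_trans (away w w0 w4).
- by move=> w w0 w4; rewrite invr_eq0 fh0.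
have cX m : (fun x : C => x ^+ m) @ (0 : C)^' --> (0 : C) ^+ m.
  exact/(@cderivable_cvg_punctured (fun x => x ^+ m))/cderivableX/cderivable_id.
have cVk : (fun x => ((f x - f h)^-1 / x ^+ k)^-1) @ (0 : C)^' --> b^-1.
  by apply: cvgV.
have ck : (fun x => f x * x ^+ k) @ (0 : C)^' --> f h * 0 ^+ k + b^-1.
  have ch : (fun=> f h) @ (0 : C)^' --> f h by exact: cvg_cst.
  have H : (fun x => f h * x ^+ k + ((f x - f h)^-1 / x ^+ k)^-1) @ (0 : C)^' -->
      f h * 0 ^+ k + b^-1.
    by apply: cvgD; [apply: cvgM; [exact: ch|exact: cX]|exact: cVk].
  apply: (cvg_punctured_eq r4 _ H) => w w0.
  rewrite subr0 => w4; rewrite /= invf_div invrK.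
  by move: (w ^+ k) (f w) (f h) => u v s; ring.
have k0 : k = 0%N.
  case: k {kb cVk} ck => // k ck; exfalso.
  have b0' : f h * 0 ^+ k.+1 + b^-1 != 0 by rewrite expr0n mulr0 add0r invr_eq0.
  by have /eqP := winding_limit (n := k.+1) b0' wf ck.
move: ck; rewrite k0 expr0 mulr1 => fa; set a := f h + b^-1 in fa.
have fB : exists2 r : R, 0 < r < 1 & forall w, w != 0 -> cmod w < r -> cmod (f w) <= cmod a + 1.
  move/cvg_punctured_cmodP: fa => /(_ 1 ltr01)[r r0 rP].
  exists (Num.min r (1 / 2)).
    by rewrite lt_min r0 gt_min; apply/andP; split; [lra|apply/orP; right; lra].
  move=> w w0; rewrite lt_min => /andP[wr _].
  have := rP w w0; rewrite subr0 => /(_ wr); rewrite expr0 mulr1.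
  by have := ler_cmodD (f w - a) a; rewrite subrK; lra.
have [r /andP[r0 r1] rP] := fB.
have [||m [c [c0 mc]]] := zero_order r0 _ rP.
- by move=> w w0 wr; apply: df => //; exact: lt_trans wr r1.
- by move=> w w0 wr; apply: f0 => //; exact: lt_trans wr r1.
have mE := winding_limit (n := - (m%:Z)) c0 wf.
have m1 : m = 1%N.
  suff : - m%:Z = -1 by lia.
  apply: mE; apply: (cvg_punctured_eq ltr01 _ mc) => w _ _.
  by rewrite exprnN.
by exists c; split; [exact: c0|rewrite m1 in mc; exact: mc].
Qed.

End SimpleZero.
(** * Schwarz's lemma for f and for its inverse *)

Section Exhaustion.
Context {R : realType}.
Notation C := (Cplx R).
Implicit Types (f F : C -> C) (z w v : C).

Lemma compact_increasing_cover (K : set C) (U : nat -> set C) : compact K ->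
  (forall n z, U n z -> nbhs z (U n)) ->
  (forall m n, (m <= n)%N -> U m `<=` U n) ->
  (forall z, K z -> exists n, U n z) -> exists n, K `<=` U n.
Proof.
move=> cK oU mU KU; apply: contrapT => noU.
have [x xP] : {x : nat -> C & forall n, K (x n) /\ ~ U n (x n)}.
  apply: (@choice _ _ (fun n z => K z /\ ~ U n z)) => n; apply: contrapT => nx.
  apply: noU; exists n => z Kz; apply: contrapT => nUz.
  by apply: nx; exists z.
have [|p [Kp pcl]] := cK (x @ \oo) _; first by exists 0%N => // n _; case: (xP n).
have [N UN] := KU p Kp.
have [||_ [[n Nn <-] /(mU _ _ Nn)]] := pcl (x @` [set n | (N <= n)%N]) (U N).
- by exists N => // n Nn; exists n.
- exact: oU.
by case: (xP n).
Qed.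

Lemma limit_maximum_principle F (b : C) (rho M : R) : 0 < rho -> 0 <= M ->
  (forall w, w != 0 -> cmod w <= rho -> derivable F w 1) ->
  F x @[x --> (0 : C)^'] --> b ->
  (forall w, cmod w = rho -> cmod (F w) <= M) ->
  forall w, w != 0 -> cmod w <= rho -> cmod (F w) <= M.
Proof.
move=> rho0 M0 dF Fb FM w w0 wr.
apply: (@punctured_maximum_principle R F (fun x => x) 0 rho M rho0 M0).
- by move=> x; exact: cderivable_id.
- by move=> x; rewrite subr0 => xr x0; exact: dF.
- move=> x _ ->; exists (cmod b + 1).
  move/cvg_punctured_cmodP: Fb => /(_ 1 ltr01)[d d0 dP].
  apply/nbhs_cmodP; exists d => // y yd y0; have := dP y y0 yd.
  by have := ler_cmodD (F y - b) b; rewrite subrK; lra.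
- by move=> x; rewrite subr0 => xr _; exact: FM.
- by rewrite subr0.
- exact: w0.
Qed.

Lemma schwarz f (b : C) :
  (forall w, w != 0 -> cmod w < 1 -> derivable f w 1) ->
  (fun x => f x / x) @ (0 : C)^' --> b ->
  (forall w, w != 0 -> cmod w < 1 -> cmod (f w) < 1) ->
  forall w, w != 0 -> cmod w < 1 -> cmod (f w) <= cmod w.
Proof.
move=> df fb f1 w w0 w1; have cw0 : 0 < cmod w by rewrite cmod_gt0.
suff key rho : cmod w <= rho -> rho < 1 -> rho * cmod (f w) <= cmod w.
  rewrite leNgt; apply/negP => fw; have fw1 := f1 w w0 w1.
  pose q := Num.max (cmod w) ((1 + cmod w / cmod (f w)) / 2).
  have f0 : 0 < cmod (f w) by exact: lt_trans fw.
  have wf1 : cmod w / cmod (f w) < 1 by rewrite ltr_pdivrMr// mul1r.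
  have qw : cmod w <= q by rewrite le_max lexx.
  have q1 : q < 1 by rewrite gt_max w1; lra.
  have qf : cmod w / cmod (f w) < q by rewrite lt_max; apply/orP; right; lra.
  by have := key q qw q1; rewrite leNgt -ltr_pdivrMr// qf.
move=> wr r1; have r0 : 0 < rho by exact: lt_le_trans wr.
have ri : 0 <= rho^-1 by rewrite invr_ge0 ltW.
have := @limit_maximum_principle (fun x => f x / x) b rho rho^-1 r0 ri _ fb _ w w0 wr.
rewrite cmodM cmodV => H; rewrite mulrC -ler_pdivlMr// -ler_pdivrMl// mulrC; apply: H.
- move=> x x0 xr; apply: cderivableM; first by apply: df => //; exact: le_lt_trans r1.
  by apply: cderivableV; [exact: x0|exact: cderivable_id].
- move=> x xr; have x0 : x != 0 by rewrite -cmod_gt0 xr.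
  rewrite cmodM cmodV xr ler_piMl//; apply/ltW/f1 => //.
  by rewrite xr.
Qed.

Lemma image_nbhs f (U : set C) z : U z -> nbhs z U ->
  (forall w, U w -> derivable f w 1) ->
  (forall x y, U x -> U y -> f x = f y -> x = y) ->
  nbhs (f z) (f @` U).
Proof.
move=> Uz /nbhs_cmodP[d d0 dP] df injf.
have d2 : 0 < d / 2 by rewrite divr_gt0.
have Ud w : cmod (w - z) <= d / 2 -> U w by move=> wz; apply: dP; lra.
have [|||e e0 eP] := @open_mapping R f z (f z) (d / 2) d2.
- by move=> w _ /Ud; exact: df.
- exact/cderivable_cvg_punctured/df.
- move=> w wz; apply/eqP => fwz.
  have wE : w = z by apply: injf => //; apply: Ud; rewrite wz.
  by move: wz d2; rewrite wE subrr cmod0 => <-; rewrite ltxx.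
apply/nbhs_cmodP; exists e => // v vz.
have [->|nv] := eqVneq v (f z); first by exists z.
by have [x [_ /ltW/Ud Ux <-]] := eP v nv vz; exists x.
Qed.

(** The open mapping theorem at 0, to which f extends by the value 0. *)
Lemma simple_zero_covers f (b : C) :
  (forall w, w != 0 -> cmod w < 1 -> derivable f w 1) ->
  (forall w, w != 0 -> cmod w < 1 -> f w != 0) ->
  (fun x => f x / x) @ (0 : C)^' --> b ->
  exists2 d : R, 0 < d & forall v, v != 0 -> cmod v < d ->
    exists z, [/\ z != 0, cmod z < 1 / 2 & f z = v].
Proof.
move=> df f0 fb; have r2 : (0 : R) < 1 / 2 by lra.
have fz : f x @[x --> (0 : C)^'] --> (0 : C).
  have xz : (fun x : C => x) @ (0 : C)^' --> (0 : C).
    exact/(@cderivable_cvg_punctured R (fun x => x))/cderivable_id.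
  have H : (fun x => f x / x * x) @ (0 : C)^' --> b * 0.
    by apply: cvgM; [exact: fb|exact: xz].
  rewrite mulr0 in H; apply: (cvg_punctured_eq ltr01 _ H) => w w0 _.
  by rewrite divfK.
have [||d d0 dP] := @open_mapping R f 0 0 (1 / 2) r2 _ fz.
- by move=> w w0; rewrite subr0 => wr; apply: df => //; lra.
- move=> w; rewrite subr0 => wr; apply: f0; last by rewrite wr; lra.
  by rewrite -cmod_gt0 wr.
exists d => // v v0 vd; have [|z [z0]] := dP v v0; first by rewrite subr0.
by rewrite subr0 => z2 fzv; exists z.
Qed.

(** Schwarz's lemma for the inverse of f on the disk of radius r, stated without
    the inverse: x / f(x) is at most 1 / r near the unit circle, because the disk
    of radius r is already covered by a smaller disk. *)
Lemma schwarz_expanding f (b : C) (r : R) : 0 < r ->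
  (forall w, w != 0 -> cmod w < 1 -> derivable f w 1) ->
  (forall z w, z != 0 -> w != 0 -> cmod z < 1 -> cmod w < 1 -> f z = f w -> z = w) ->
  (forall w, w != 0 -> cmod w < 1 -> f w != 0) ->
  b != 0 -> (fun x => f x / x) @ (0 : C)^' --> b ->
  (forall v, v != 0 -> cmod v <= r -> exists z, [/\ z != 0, cmod z < 1 & f z = v]) ->
  forall w, w != 0 -> cmod w < 1 -> r * cmod w <= cmod (f w).
Proof.
move=> r0 df injf f0 b0 fb fr.
have [d d0 dP] := simple_zero_covers df f0 fb.
(* These radii increase to 1 and start at 1/2, the radius of the disk that covers
   the values close to 0. *)
pose rad n : R := 1 - n.+2%:R^-1.
have rad1 n : rad n < 1 by rewrite /rad ltrBlDr ltrDl invr_gt0.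
have rad2 n : 1 / 2 <= rad n.
  have : (n.+2%:R^-1 : R) <= 2^-1 by rewrite lef_pV2 ?posrE// ler_nat.
  by rewrite /rad; move: (n.+2%:R^-1) => q; lra.
have radI m n : (m <= n)%N -> rad m <= rad n.
  by move=> mn; rewrite /rad lerB// lef_pV2 ?posrE// ler_nat.
pose D n : set C := [set z | z != 0 /\ cmod z < rad n].
have [||||n nP] := @compact_increasing_cover [set v | d <= cmod (v - 0) <= r]
    (fun n => f @` D n).
- exact: compact_annulus.
- move=> n _ [z [z0 zr] <-]; apply: image_nbhs.
  + by split.
  + have [zp rp] : 0 < cmod z /\ 0 < rad n - cmod z by rewrite cmod_gt0 subr_gt0.
    apply/nbhs_cmodP; exists (Num.min (cmod z) (rad n - cmod z)).
      by rewrite lt_min zp.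
    move=> w; rewrite lt_min => /andP[wz wr]; split.
      by apply/eqP => wE; move: wz; rewrite wE sub0r cmodN ltxx.
    by have := ler_cmodD (w - z) z; rewrite subrK; lra.
  + by move=> w [w0 wr]; apply: df; [exact: w0|exact: lt_trans (rad1 n)].
  + by move=> x y [x0 xr] [y0 yr]; apply: injf => //; exact: lt_trans (rad1 n).
- move=> m n mn _ [z [z0 zr] <-]; exists z => //; split => //.
  exact: lt_le_trans (radI _ _ mn).
- move=> v; rewrite /= subr0 => /andP[dv vr].
  have v0 : v != 0 by rewrite -cmod_gt0; exact: lt_le_trans dv.
  have [z [z0 z1 fz]] := fr v v0 vr.
  have gap : 0 < 1 - cmod z by lra.
  pose N := Num.bound (1 - cmod z)^-1.
  exists N, z => //; split => //.
  have NP : (1 - cmod z)^-1 < N%:R.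
    by rewrite archi_boundP// invr_ge0 ltW.
  rewrite /rad ltrBrDr -ltrBrDl -[ltRHS]invrK ltf_pV2 ?posrE ?invr_gt0//.
  by apply: (lt_trans NP); rewrite ltr_nat.
have cov v : v != 0 -> cmod v <= r -> exists z, [/\ z != 0, cmod z < rad n & f z = v].
  move=> v0 vr; have [vd|dv] := ltP (cmod v) d.
    by have [z [z0 z2 fz]] := dP v v0 vd; exists z; split=> //; exact: lt_le_trans (rad2 n).
  have [|z [z0 zr] fz] := nP v; first by rewrite /= subr0 dv vr.
  by exists z.
have big w : rad n <= cmod w -> cmod w < 1 -> r < cmod (f w).
  move=> wr w1; have w0 : w != 0 by rewrite -cmod_gt0; have := rad2 n; lra.
  rewrite ltNge; apply/negP => fw.
  have [z [z0 zr fz]] := cov _ (f0 w w0 w1) fw.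
  have E : z = w by apply: injf => //; exact: lt_trans (rad1 n).
  by move: zr; rewrite E; lra.
move=> w w0 w1; pose rho := Num.max (cmod w) (rad n).
have [wr nr r1] : [/\ cmod w <= rho, rad n <= rho & rho < 1].
  by rewrite !le_max !lexx orbT gt_max w1 rad1.
have rho0 : 0 < rho by have := rad2 n; lra.
have rV : 0 <= r^-1 by rewrite invr_ge0 ltW.
have fb' : (fun x => x / f x) @ (0 : C)^' --> b^-1.
  have H : (fun x => (f x / x)^-1) @ (0 : C)^' --> b^-1 by apply: cvgV.
  by apply: (cvg_punctured_eq ltr01 _ H) => x _ _; rewrite invf_div.
have := @limit_maximum_principle (fun x => x / f x) b^-1 rho r^-1 rho0 rV _ fb' _ w w0 wr.
have fw0 : 0 < cmod (f w) by rewrite cmod_gt0 f0.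
rewrite cmodM cmodV ler_pdivrMr// => H; rewrite -ler_pdivlMl//; apply: H.
- move=> x x0 xr; have x1 : cmod x < 1 by exact: le_lt_trans r1.
  by apply: cderivableM; [exact: cderivable_id|apply: cderivableV; [exact: f0|exact: df]].
- move=> x xr; have [rx x1] : rad n <= cmod x /\ cmod x < 1 by rewrite xr.
  have fx := big x rx x1; have fx0 : 0 < cmod (f x) by exact: lt_trans fx.
  rewrite cmodM cmodV -[leRHS]mul1r ler_pM ?cmod_ge0 ?invr_ge0 ?cmod_ge0 ?(ltW x1)//.
  by rewrite lef_pV2 ?posrE// ltW.
Qed.

End Exhaustion.
(** * Ranges of standard Loewner chains *)

Section LoewnerChains.
Context {R : realType}.
Notation C := (Cplx R).
Implicit Types (r : R -> R) (f : R -> C -> C) (phi : R -> R -> C -> C) (z w : C).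

Lemma annulusE (a : R) z : annulus a z <-> a < cmod z /\ cmod z < 1.
Proof.
rewrite /annulus /= ltc_normE' -[1]/((1 : R)%:C%C) ltc_normE.
by split=> /andP.
Qed.

Lemma annulus0E z : annulus 0 z <-> z != 0 /\ cmod z < 1.
Proof. by rewrite annulusE cmod_gt0. Qed.

Lemma exterior_diskE z : exterior_disk z <-> 1 < cmod z.
Proof. by rewrite /exterior_disk /= -[1 in X in X <-> _]/((1 : R)%:C%C) ltc_normE'. Qed.

Lemma cvg_on_compacta0P (D : set C) (g : R -> C -> C) :
  cvg_on_compacta D g (fun=> 0) <->
  forall K : set C, compact K -> K `<=` D -> forall e : R, 0 < e ->
    exists M : R, forall t, M < t -> forall z, K z -> cmod (g t z) < e.
Proof.
split=> gD K cK KD.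
  move=> e e0; have e0' : 0 < (e%:C%C : R[i]) by rewrite ltcR.
  have [|M [_ MP]] := gD K cK KD [set h | forall z, K z -> ball (0 : C) e%:C%C (h z)].
    apply/uniform_nbhs; exists [set p | ball p.1 e%:C%C p.2].
    by split=> //; rewrite -entourage_ballE; exists e%:C%C.
  exists M => t /MP /= tP z /tP; rewrite -ball_normE /= sub0r normrN.
  by rewrite ltc_normE.
move=> P /uniform_nbhs[E [entE EP]].
move: entE; rewrite -entourage_ballE => -[e /= e0 eE].
case: e e0 eE => a b; rewrite ltcE /= => /andP[/eqP-> a0] eE.
have [M MP] := gD K cK KD a a0.
exists M; split; first exact: num_real.
move=> t /MP tP; apply: EP => z Kz; apply: eE => /=.
by rewrite -ball_normE /= sub0r normrN ltc_normE tP.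
Qed.

Lemma omega_gt0 (x : R) : 0 < x < 1 -> 0 < omega x.
Proof.
move=> /andP[x0 x1]; rewrite /omega gt_eqF// mulNr -mulrN -invrN.
by rewrite divr_gt0 ?pi_gt0// oppr_gt0 ln_lt0// x0.
Qed.

(** As omega is positive on ]0, 1[ and vanishes at 0, a nonincreasing omega (r t)
    stays 0 once it is 0. *)
Lemma degenerate_after d r (T t : R) : canonical_domain_system d r ->
  0 <= T -> r T = 0 -> T <= t -> r t = 0.
Proof.
move=> [r01 _ om] T0 rT Tt; apply/eqP/negPn/negP => rt0.
have /andP[rt rt1] := r01 t (le_trans T0 Tt).
have /omega_gt0 : 0 < r t < 1 by rewrite rt1 lt_def rt0 rt.
by have := om T t T0 Tt; rewrite rT {2}/omega eqxx; lra.
Qed.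

Context (r : R -> R) (phi : R -> R -> C -> C) (f : R -> C -> C) (T : R).
Context (T0 : 0 <= T) (rT : forall t, T <= t -> r t = 0).
Context (stdf : standard_loewner_chain r f) (assf : associated r f phi).

Lemma limit_radius : lim (r t @[t --> +oo]) = 0.
Proof.
apply/cvg_lim => //; apply: (@cvg_near_cst _ _ _ _ (pinfty_nbhs R)).
by exists T; split; [exact: num_real|move=> t /ltW/rT].
Qed.

Lemma chain_range_cases : [\/ chain_range r f = punctured_disk,
  chain_range r f = exterior_disk | chain_range r f = punctured_plane].
Proof. by case: stdf => _ _ _; apply; exact: limit_radius. Qed.

Lemma chain_in_range t z : 0 <= t -> annulus (r t) z -> chain_range r f (f t z).
Proof. by move=> t0 tz; exists t => //; exists z. Qed.

Lemma chain_range_neq0 w : chain_range r f w -> w != 0.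
Proof.
case: chain_range_cases => ->.
- by move=> /annulus0E[].
- by move=> /exterior_diskE w1; rewrite -cmod_gt0; lra.
- by [].
Qed.

Lemma chain_univalent t : 0 <= t -> univalent (annulus (r t)) (f t).
Proof. by case: stdf => -[d _ [+ _ _]] _ _ _ => H; exact: H. Qed.

Lemma chain_image_increasing s t z : 0 <= s -> s <= t -> annulus (r s) z ->
  exists w, annulus (r t) w /\ f t w = f s z.
Proof.
case: stdf => -[d _ [_ inc _]] _ _ _ s0; rewrite le_eqVlt => /orP[/eqP<-|st] sz.
  by exists z.
by have [|w tw <-] := inc s t s0 st (f s z); [exists z|exists w].
Qed.

Section DegeneratePart.
Context (t : R) (Tt : T <= t).

Let t0 : 0 <= t. Proof. exact: le_trans Tt. Qed.
Let rt : r t = 0. Proof. exact: rT. Qed.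

Lemma chain_derivable w : w != 0 -> cmod w < 1 -> derivable (f t) w 1.
Proof.
move=> w0 w1; have [hol _] := chain_univalent t0.
by apply: hol; rewrite rt; apply/annulus0E.
Qed.

Lemma chain_injective z w : z != 0 -> w != 0 -> cmod z < 1 -> cmod w < 1 ->
  f t z = f t w -> z = w.
Proof.
move=> z0 w0 z1 w1; have [_ inj] := chain_univalent t0.
by apply: inj; rewrite inE rt; apply/annulus0E.
Qed.

Lemma chain_neq0 w : w != 0 -> cmod w < 1 -> f t w != 0.
Proof.
move=> w0 w1; apply: chain_range_neq0; apply: chain_in_range => //.
by rewrite rt; apply/annulus0E.
Qed.

Lemma chain_simple_zero : exists b, b != 0 /\ (fun x => f t x / x) @ (0 : C)^' --> b.
Proof.
apply: univalent_simple_zero; [exact: chain_derivable|exact: chain_injective|exact: chain_neq0|].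
move=> rho rho01; case: stdf => _ ind _ _.
have cc : closed_curve (annulus (r t)) (circle rho).
  by rewrite rt; exact: closed_curve_circle.
have := ind t (circle rho) t0 cc; rewrite index_circle// => i1.
have [wex|nw] := pselect (exists n, winding (f t \o circle rho) n).
  by rewrite -i1; exact: (xgetPex 0 wex).
(* Without a continuous argument the index would have its default value 0. *)
by move: i1; rewrite /index0 xgetPN// => n wn; apply: nw; exists n.
Qed.

End DegeneratePart.

Lemma chain_range_not_exterior : chain_range r f <> exterior_disk.
Proof.
move=> ext; have [b [b0 fb]] := chain_simple_zero (lexx T).
have [d d0 dP] := simple_zero_covers (@chain_derivable T (lexx T))
  (@chain_neq0 T (lexx T)) fb.
pose s : R := Num.min (d / 2) (1 / 2).
have [s0 sd s1] : [/\ 0 < s, s < d & s < 1].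
  have : s <= d / 2 by rewrite ge_min lexx.
  have : s <= 1 / 2 by rewrite ge_min lexx orbT.
  have : 0 < s by rewrite lt_min !divr_gt0.
  by move: s => s *; split; lra.
have sE : cmod (s%:C%C : C) = s by rewrite cmod_real gtr0_norm.
have [||z [z0 z2 fz]] := dP (s%:C%C : C).
- by rewrite -cmod_gt0 sE.
- by rewrite sE.
have : chain_range r f (f T z).
  by apply: chain_in_range => //; rewrite rT//; apply/annulus0E; split=> //; lra.
by rewrite ext fz => /exterior_diskE; rewrite sE; lra.
Qed.

(** On the disk range, |f_0(z)| = |f_t(phi_{0,t}(z))| <= |phi_{0,t}(z)| for every
    large t, by Schwarz's lemma. *)
Lemma disk_range_not_cvg : 0 <= r 0 < 1 -> chain_range r f = punctured_disk ->
  ~ cvg_on_compacta (annulus (r 0)) (phi 0) (fun=> 0).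
Proof.
move=> /andP[r0 r1] disk /cvg_on_compacta0P conv.
pose z : C := ((1 + r 0) / 2)%:C%C.
have zE : cmod z = (1 + r 0) / 2.
  by rewrite cmod_real ger0_norm// divr_ge0// addr_ge0.
have Dz : annulus (r 0) z by apply/annulusE; rewrite zE; split; lra.
have f0z : 0 < cmod (f 0 z).
  by rewrite cmod_gt0; apply: chain_range_neq0; exact: chain_in_range.
have [|M MP] := conv [set z] (@compact_set1 _ z) _ _ f0z; first by move=> _ ->.
pose t := Num.max T (M + 1).
have Tt : T <= t by rewrite le_max lexx.
have Mt : M < t by rewrite lt_max ltrDl ltr01 orbT.
have [Dt ft] := assf (lexx 0) (le_trans T0 Tt) Dz.
have [p0 p1] : phi 0 t z != 0 /\ cmod (phi 0 t z) < 1.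
  by move: Dt; rewrite rT// => /annulus0E.
have [b [_ fb]] := chain_simple_zero Tt.
have bd w : w != 0 -> cmod w < 1 -> cmod (f t w) < 1.
  move=> w0 w1; have : chain_range r f (f t w).
    apply: chain_in_range; first exact: le_trans Tt.
    by rewrite rT//; apply/annulus0E.
  by rewrite disk => /annulus0E[].
have := schwarz (chain_derivable Tt) fb bd p0 p1.
by rewrite ft leNgt MP.
Qed.

(** The images f_t(D_t), which increase to the whole punctured plane, contain any
    given punctured disk for large t; then f_t^{-1} contracts it strongly. *)
Lemma plane_range_cvg : 0 <= r 0 < 1 -> chain_range r f = punctured_plane ->
  cvg_on_compacta (annulus (r 0)) (phi 0) (fun=> 0).
Proof.
move=> r01 plane; apply/cvg_on_compacta0P => K cK KD e e0.
have [B B0 BP] : exists2 B, 0 < B & forall z, K z -> cmod (f 0 z) <= B.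
  have [K0|/set0P/negP] := pselect (K !=set0); last first.
    by rewrite negbK => /eqP ->; exists 1.
  have cf : {within K, continuous (fun x => cmod (f 0 x))}.
    apply: continuous_in_subspaceT => x; rewrite inE => /KD Dx.
    have [hol _] := chain_univalent (lexx 0).
    exact/cvg_at_cmod/cderivable_continuous/hol.
  have [c _ cmax] := compact_EVT_max K0 cK cf.
  exists (cmod (f 0 c) + 1); first by rewrite ltr_wpDl// cmod_ge0.
  by move=> z Kz; rewrite (le_trans (cmax z _)) ?inE// lerDl.
pose q := (B + 1) / e; have q0 : 0 < q by rewrite divr_gt0// ltr_wpDl// ltW.
have covers t z : T <= t -> annulus (r t) z <-> z != 0 /\ cmod z < 1.
  by move=> Tt; rewrite rT//; exact: annulus0E.
have [b [b0 fb]] := chain_simple_zero (lexx T).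
have [d d0 dP] := simple_zero_covers (@chain_derivable T (lexx T))
  (@chain_neq0 T (lexx T)) fb.
have TnT n : T <= T + n%:R by rewrite lerDl.
have Tn0 n : 0 <= T + n%:R by exact: le_trans (TnT n).
have [||||n nP] := @compact_increasing_cover R [set v | d <= cmod (v - 0) <= q]
    (fun n => f (T + n%:R) @` annulus (r (T + n%:R))).
- exact: compact_annulus.
- move=> n _ [z nz <-]; apply: image_nbhs.
  + exact: nz.
  + move/covers: nz => -/(_ (TnT n))[z0 z1].
    have [zp rp] : 0 < cmod z /\ 0 < 1 - cmod z by rewrite cmod_gt0 subr_gt0.
    apply/nbhs_cmodP; exists (Num.min (cmod z) (1 - cmod z)).
      by rewrite lt_min zp.
    move=> w; rewrite lt_min => /andP[wz wr]; apply/covers => //; split.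
      by apply/eqP => wE; move: wz; rewrite wE sub0r cmodN ltxx.
    by have := ler_cmodD (w - z) z; rewrite subrK; lra.
  + by move=> w /covers-/(_ (TnT n))[w0 w1]; exact: (chain_derivable (TnT n)).
  + move=> x y /covers-/(_ (TnT n))[x0 x1] /covers-/(_ (TnT n))[y0 y1].
    exact: (chain_injective (TnT n)).
- move=> m n mn _ [z mz <-].
  have mn' : T + m%:R <= T + n%:R by rewrite lerD2l ler_nat.
  by have [w [nw <-]] := chain_image_increasing (Tn0 m) mn' mz; exists w.
- move=> v; rewrite /= subr0 => /andP[dv _].
  have : chain_range r f v.
    by rewrite plane /punctured_plane /= -cmod_gt0; exact: lt_le_trans dv.
  move=> [s /= s0 [z sz <-]].
  have sn : s <= T + (Num.bound s)%:R.
    by rewrite (le_trans (ltW (archi_boundP s0)))// lerDr.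
  by exists (Num.bound s); have [w [nw <-]] := chain_image_increasing s0 sn sz; exists w.
exists (T + n%:R) => t /ltW nt z Kz.
have Tt : T <= t by exact: le_trans (TnT n) nt.
have [bt [bt0 ftb]] := chain_simple_zero Tt.
have cov v : v != 0 -> cmod v <= q -> exists w, [/\ w != 0, cmod w < 1 & f t w = v].
  move=> v0 vq; have [vd|dv] := ltP (cmod v) d.
    have [w [w0 w2 <-]] := dP v v0 vd.
    have Dw : annulus (r T) w by apply/covers => //; split=> //; lra.
    have [x [/covers-/(_ Tt)[x0 x1] <-]] := chain_image_increasing T0 Tt Dw.
    by exists x.
  have [|w nw <-] := nP v; first by rewrite /= subr0 dv vq.
  have [x [/covers-/(_ Tt)[x0 x1] <-]] := chain_image_increasing (Tn0 n) nt nw.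
  by exists x.
have [/covers-/(_ Tt)[p0 p1] ft] := assf (lexx 0) (le_trans T0 Tt) (KD z Kz).
have := schwarz_expanding q0 (chain_derivable Tt) (chain_injective Tt)
  (chain_neq0 Tt) bt0 ftb cov p0 p1.
rewrite ft => H; have := le_trans H (BP z Kz).
rewrite /q mulrAC ler_pdivrMr// => H2.
have : (B + 1) * cmod (phi 0 t z) < (B + 1) * e by lra.
by rewrite ltr_pM2l// ltr_wpDl// ltW.
Qed.

End LoewnerChains.

Theorem proposition1p14 (R : realType) (d : \bar R) (r : R -> R)
  (phi : R -> R -> Cplx R -> Cplx R) :
  (1 <= d)%E ->
  canonical_domain_system d r ->
  evolution_family d r phi ->
  (exists f, standard_loewner_chain r f /\ associated r f phi) ->
  (exists2 T : R, 0 <= T & r T = 0) ->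
  (cvg_on_compacta (annulus (r 0)) (phi 0) (fun _ => 0) -> type_IV r phi) /\
  (~ cvg_on_compacta (annulus (r 0)) (phi 0) (fun _ => 0) -> type_II r phi).
Proof.
move=> _ cds _ exf [T T0 rT0].
have rT t : T <= t -> r t = 0 by exact: degenerate_after cds T0 rT0.
have r01 : 0 <= r 0 < 1 by case: cds => r01 _ _; exact: r01.
split=> conv; split=> // f stdf assf.
- case: (chain_range_cases rT stdf) => // [disk|ext].
    by case: (disk_range_not_cvg T0 rT stdf assf r01 disk conv).
  by case: (chain_range_not_exterior T0 rT stdf ext).
- case: (chain_range_cases rT stdf) => // [ext|plane].
    by case: (chain_range_not_exterior T0 rT stdf ext).
  by case: conv; exact: (plane_range_cvg T0 rT stdf assf r01 plane).
Qed.
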